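(* Let $C=p_r\dots p_s$ be a configuration of g-2PATH with free left hand that satisfies the condition of noninterference of extensions (CNI). When $-r\le s$, let $j_0$ be the minimal integer $j$ with $0\le j\le s$ such that $-r+g(r,j)\le j+1$. Then \[\mathrm{mft}_{\text{g-2PATH}}(C)=\begin{cases}-2r+s & \text{if } -r>s,\\ -r+2j_0+1 & \text{if } -r\le s \text{ and } -r+g(r,j_0)=j_0+1,\\ -r+2j_0 & \text{if } -r\le s \text{ and } -r+g(r,j_0)<j_0+1.\end{cases}\]
   Context: Positions are elements of $\mathbb{Z}^2$; with $\epsilon_0=(1,0),\epsilon_1=(0,1),\epsilon_2=(-1,0),\epsilon_3=(0,-1)$, positions $p,p'$ are adjacent if $p'-p$ is some $\epsilon_i$. A configuration of g-2PATH is a sequence $C=p_r\dots p_s$ ($r\le0\le s$) of positions with $p_0=(0,0)$ (the general), consecutive positions adjacent, all positions distinct, and $p_l,p_m$ not adjacent whenever $|l-m|\ge2$. For $p\in C$, $\mathrm{bc}_C(p)=(b_0,\dots,b_3)$ with $b_i=1$ iff $p+\epsilon_i\in C$. Firing squad model (boundary-sensitive): a finite automaton $A$ has a finite state set with quiescent state $\mathrm{Q}$, general states $\mathrm{G}_0,\dots,\mathrm{G}_{m-1}$, firing states $\mathcal F\not\ni\mathrm{Q}$, a map $\tau:\{0,1\}^4\to\{0,\dots,m-1\}$ and a transition function from the current state and the four neighbour states ($\#$ where no node), with $\mathrm{Q}$ stable when all inputs are in $\{\mathrm{Q},\#\}$. On $C$, at time $0$ node $(0,0)$ is in $\mathrm{G}_{\tau(\mathrm{bc}_C((0,0)))}$,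 others in $\mathrm{Q}$, synchronous updates. $A$ is a solution of g-2PATH if for every configuration $C$ there is $t_C$ with no node in $\mathcal F$ before $t_C$ and all nodes in $\mathcal F$ at $t_C=:\mathrm{ft}(C,A)$. $\mathrm{mft}_{\text{g-2PATH}}(C)=\min_A\mathrm{ft}(C,A)$ over solutions. For $r\le i\le0\le j\le s$: $W(i,j)$ is the set of pairs $(x_0,x_1)$ of finite, possibly empty, sequences of positions such that $x_0p_i\dots p_jx_1$ is a configuration $C'$ of g-2PATH (general at $p_0$) with $\mathrm{bc}_{C'}(p_l)=\mathrm{bc}_C(p_l)$ for $i\le l\le j$; $U(i,j)$, $V(i,j)$ are the sets of first, resp. second, components of its elements; $f(i,j)=\sup\{|x_0|:x_0\in U(i,j)\}$, $g(i,j)=\sup\{|x_1|:x_1\in V(i,j)\}$ ($|x|$ = number of positions; possibly $\infty$). $\mathrm{NI}(i,j)$ means $W(i,j)=U(i,j)\times V(i,j)$. $I=\{(i,j): r\le i-1,\ W(i,j)$ infinite, $W(i-1,j)$ finite$\}$, $J=\{(i,j): j+1\le s,\ W(i,j)$ infinite, $W(i,j+1)$ finite$\}$, $K=\{(i,j): W(i,j)$ finite$\}$. $C$ satisfies CNI if $\mathrm{NI}(i,j)$ holds for all $(i,j)\in I\cup J\cup K$. The left hand of $C$ is free if $r=0$ or ($r<0$ and $f(r+1,s)=\infty$). *)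

(* Defs.v *)
From Stdlib Require Import ClassicalEpsilon.
From HB Require Import structures.
From mathcomp Require Import all_boot all_order all_algebra.
Set Implicit Arguments. Unset Strict Implicit. Unset Printing Implicit Defensive.
Import Order.TTheory GRing.Theory Num.Theory.
Local Open Scope ring_scope.

Definition pos := (int * int)%type.
Definition origin : pos := (0, 0).
Definition padd (p q : pos) : pos := (p.1 + q.1, p.2 + q.2).

Definition eps (i : 'I_4) : pos :=
  match val i with
  | 0%N => (1, 0)
  | 1%N => (0, 1)
  | 2%N => (-1, 0)
  | _ => (0, -1)
  end.

Definition adjacent (p p' : pos) : bool := [exists i : 'I_4, p' == padd p (eps i)].

(** A configuration p_r ... p_s is represented by the sequence [c] of its
    positions; the general is the (unique) entry equal to (0,0), so that
    r = - index (0,0) c and p_l = nth (l - r). *)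
Definition is_config (c : seq pos) : Prop :=
  [/\ origin \in c,
      uniq c,
      (forall l : nat, (l.+1 < size c)%N -> adjacent (nth origin c l) (nth origin c l.+1))
    & (forall l m : nat, (l < size c)%N -> (m < size c)%N -> (l + 2 <= m)%N ->
         ~~ adjacent (nth origin c l) (nth origin c m))].

Definition r_of (c : seq pos) : int := - (index origin c)%:Z.
Definition s_of (c : seq pos) : int := (size c)%:Z - 1 - (index origin c)%:Z.

Definition pt (c : seq pos) (l : int) : pos := nth origin c (absz (l - r_of c)).

Definition seg (c : seq pos) (i j : int) : seq pos :=
  take (absz (j - i + 1)) (drop (absz (i - r_of c)) c).

Definition bc (c : seq pos) (p : pos) : 'I_4 -> bool := fun i => padd p (eps i) \in c.

Record automaton := Automaton {
  St : finType;
  Qst : St;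
  ngen : nat;
  Gst : 'I_ngen -> St;
  Fst : {set St};
  tau : ('I_4 -> bool) -> 'I_ngen;
  (* delta current n_0 n_1 n_2 n_3, where n_i is the state of the node at
     p + eps_i, or None (= #) when there is no node *)
  delta : St -> option St -> option St -> option St -> option St -> St;
  Q_notin_F : Qst \notin Fst;
  Q_stable : forall a0 a1 a2 a3 : option St,
      a0 \in [:: None; Some Qst] -> a1 \in [:: None; Some Qst] ->
      a2 \in [:: None; Some Qst] -> a3 \in [:: None; Some Qst] ->
      delta Qst a0 a1 a2 a3 = Qst
}.

Definition nbr (A : automaton) (c : seq pos) (o : pos -> St A) (p : pos) (i : 'I_4)
  : option (St A) :=
  if padd p (eps i) \in c then Some (o (padd p (eps i))) else None.

Fixpoint state (A : automaton) (c : seq pos) (t : nat) : pos -> St A :=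
  match t with
  | 0%N => fun p => if p == origin then @Gst A (@tau A (bc c origin)) else @Qst A
  | t'.+1 => fun p =>
      let o := state A c t' in
      @delta A (o p) (nbr c o p (inord 0)) (nbr c o p (inord 1))
                    (nbr c o p (inord 2)) (nbr c o p (inord 3))
  end.

Definition fires_at (A : automaton) (c : seq pos) (t : nat) : Prop :=
  (forall t' : nat, (t' < t)%N -> forall p, p \in c -> state A c t' p \notin @Fst A)
  /\ (forall p, p \in c -> state A c t p \in @Fst A).

Definition solution (A : automaton) : Prop :=
  forall c, is_config c -> exists t, fires_at A c t.

Definition mft_is (c : seq pos) (n : int) : Prop :=
  (exists A, solution A /\ exists t : nat, fires_at A c t /\ n = t%:Z)
  /\ (forall A (t : nat), solution A -> fires_at A c t -> n <= t%:Z).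

Definition W (c : seq pos) (i j : int) (x0 x1 : seq pos) : Prop :=
  let c' := x0 ++ seg c i j ++ x1 in
  is_config c' /\
  (forall l : int, i <= l <= j -> bc c' (pt c l) =1 bc c (pt c l)).

Definition U (c : seq pos) (i j : int) (x0 : seq pos) : Prop := exists x1, W c i j x0 x1.
Definition V (c : seq pos) (i j : int) (x1 : seq pos) : Prop := exists x0, W c i j x0 x1.

Definition sup_nat (P : nat -> Prop) (v : option nat) : Prop :=
  match v with
  | Some n => P n /\ (forall m, P m -> (m <= n)%N)
  | None => forall n, exists m, P m /\ (n < m)%N
  end.

Definition f (c : seq pos) (i j : int) : option nat :=
  epsilon (inhabits None) (sup_nat (fun n => exists x0, U c i j x0 /\ size x0 = n)).
Definition g (c : seq pos) (i j : int) : option nat :=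
  epsilon (inhabits None) (sup_nat (fun n => exists x1, V c i j x1 /\ size x1 = n)).

Definition NI (c : seq pos) (i j : int) : Prop :=
  forall x0 x1, U c i j x0 -> V c i j x1 -> W c i j x0 x1.

Definition W_finite (c : seq pos) (i j : int) : Prop :=
  exists l : seq (seq pos * seq pos), forall x0 x1, W c i j x0 x1 -> (x0, x1) \in l.

Definition inI (c : seq pos) (i j : int) : Prop :=
  r_of c <= i - 1 /\ ~ W_finite c i j /\ W_finite c (i - 1) j.
Definition inJ (c : seq pos) (i j : int) : Prop :=
  j + 1 <= s_of c /\ ~ W_finite c i j /\ W_finite c i (j + 1).
Definition inK (c : seq pos) (i j : int) : Prop := W_finite c i j.

Definition CNI (c : seq pos) : Prop :=
  forall i j : int, r_of c <= i <= 0 -> 0 <= j <= s_of c ->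
    inI c i j \/ inJ c i j \/ inK c i j -> NI c i j.

Definition free_left (c : seq pos) : Prop :=
  r_of c = 0 \/ (r_of c < 0 /\ f c (r_of c + 1) (s_of c) = None).

Definition cond_j (c : seq pos) (j : int) : Prop :=
  match g c (r_of c) j with
  | Some n => - r_of c + n%:Z <= j + 1
  | None => False
  end.

(* Main.v *)
(** Upper bound.  A finite-state recognizer floods the network with the facts
    "the boundary condition of p_k is the one it has in C", for [r <= k <= j].
    A node can hold all of them at time T only in a configuration
    p_r ... p_j x, and then [|x| <= g(r,j)] guarantees that all the nodes hold
    them at time T; so all of them fire at T.  On the other configurations the
    recognizer waits for the verdict of some arbitrary solution, delayed
    beyond T.  Such a solution is Minsky's recursive halving: a scout runs to
    one end, then a signal of speed 1 that bounces on the far wall meets a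
    signal of speed 1/3 in the middle, where new walls are built, and so on
    until all the nodes are walls.

    Lower bound.  Before the claimed time, p_r cannot tell C from
    C' = p_r ... p_j x with x as long as possible, and the last node of C'
    does not know yet that p_r is an end.  The left hand being free, C has
    arbitrarily long left extensions x' at p_(r+1), and NI(r+1,j) turns them
    into extensions x' p_(r+1) ... p_j x of the right part of C'; some node of
    such a configuration is still quiescent, so that neither it nor C' nor C
    can fire. *)
From HB Require Import structures.
From Stdlib Require Import FunctionalExtensionality Classical ClassicalEpsilon.
Require Import Defs.
From mathcomp Require Import all_boot all_order all_algebra zify.
Set Implicit Arguments. Unset Strict Implicit. Unset Printing Implicit Defensive.
Import Order.TTheory GRing.Theory Num.Theory.

(** * Cells and local rule of the halving automaton *)

(** [fast] and [back] are the signals of speed 1 leaving a fresh wall and coming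
    back from the opposite one, [slow0], [slow1], [slow2] the three phases of
    the signal of speed 1/3.  Cells do not know left from right: the bits
    [fast1], [back1], [scout1] (value one step ago) and [tail0], [tail1],
    [tail2] (value of [slow2] one to three steps ago) mark the cell a signal comes
    from and keep it from turning back.  [wait1] and [wait2] delay a new wall until
    these marks have vanished.  A wall emits signals when its own bits [fast]
    and [slow2] are set. *)
Record cell := Cell {
  wall : bool; fast : bool; fast1 : bool;
  slow0 : bool; slow1 : bool; slow2 : bool;
  tail0 : bool; tail1 : bool; tail2 : bool;
  back : bool; back1 : bool;
  wait1 : bool; wait2 : bool;
  scout : bool; scout1 : bool; fired : bool; aim : option 'I_4 }.

Definition cell_code (q : cell) :=
  ((wall q, fast q, fast1 q, slow0 q, slow1 q, slow2 q, tail0 q, tail1 q),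
   (tail2 q, back q, back1 q, wait1 q, wait2 q, scout q, scout1 q, fired q, aim q)).
Definition cell_decode c :=
  let: ((w, f, f1, s0, s1, s2, u0, u1), (u2, b, b1, c1, c2, m, m1, x, d)) := c in
  Cell w f f1 s0 s1 s2 u0 u1 u2 b b1 c1 c2 m m1 x d.
Lemma cell_codeK : cancel cell_code cell_decode. Proof. by case. Qed.
HB.instance Definition _ := Finite.copy cell (can_type cell_codeK).

Definition blank :=
  Cell false false false false false false false false false
       false false false false false false false None.
Definition wall_cell c1 c2 launch :=
  Cell true launch false false false launch false false false
       false false c1 c2 false false false None.
Definition plain := wall_cell false false false.
Definition launch := wall_cell false false true.
Definition fired_cell :=
  Cell false false false false false false false false false
       false false false false false false true None.

Definition nonwall (q : cell) := ~~ wall q.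

(** The signals meet in one cell when the segment has odd length, between two
    cells when it is even; the second disjunct is the segment of length 1. *)
Definition collides (q : cell) (n : pred cell -> nat) : bool :=
  [|| slow0 q && (0 < n back)%N, [&& slow0 q, fast q & n nonwall == 0%N],
      slow2 q && (0 < n back)%N | back q && (0 < n slow2)%N].

(** [n P] is the number of neighbours satisfying [P]; a missing neighbour counts
    as a wall, so that [n nonwall <= 1] detects a wall on one side. *)
Definition cell_step (q : cell) (n : pred cell -> nat) (aimed : bool) : cell :=
  if fired q then fired_cell else
  if wall q then
    if n nonwall == 0%N then fired_cell
    else wall_cell false (wait1 q) (wait2 q)
  else if collides q n then wall_cell true false false
  else if scout q && (n nonwall <= 1)%N then launch
  else Cell false ((0 < n fast)%N && ~~ fast1 q) (fast q)
    ((0 < n slow2)%N && ~~ tail2 q) (slow0 q) (slow1 q)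
    (slow2 q) (tail0 q) (tail1 q)
    (((0 < n back)%N && ~~ back1 q) || [&& fast q, ~~ slow0 q & (n nonwall <= 1)%N])
    (back q) false false
    (((0 < n scout)%N && ~~ scout1 q) || aimed) (scout q || (aim q != None)) false None.

Definition holds (P : pred cell) (o : option cell) : bool := if o is Some q then P q else false.
Definition count2 (o o' : option cell) (P : pred cell) : nat := (holds P o + holds P o')%N.
(** The last argument of [cell_step] is [false] because an [aim] exists at time 0 only; runs obey
    this law from time 1 on. *)
Definition line_law (L : nat -> int -> option cell) : Prop :=
  forall t x, L t.+1 x =
    omap (fun q => cell_step q (count2 (L t (x - 1)%R) (L t (x + 1)%R)) false) (L t x).

(** * One passage of the signals over a segment *)

Definition iswall (o : option cell) : bool := ~~ holds nonwall o.
Definition unfired (o : option cell) : bool := ~~ holds fired o.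

(** The segment has its [k] blank cells at [a + 1], ..., [a + k]. *)
Definition seg_ready (L : nat -> int -> option cell) (t : nat) (a : int) (k : nat) : Prop :=
  [/\ L t a = Some launch,
      forall y : nat, (0 < y <= k)%N -> L t (a + y%:Z)%R = Some blank
    & L t (a + k.+1%:Z)%R = None \/ L t (a + k.+1%:Z)%R = Some plain].

(** The cell at distance [y] from the launching wall, [t] steps after launch,
    before the signals meet at time [3k/2]. *)
Definition wave (k t y : nat) : cell :=
  Cell false (y == t) (y.+1 == t)
    (t.+2 == 3 * y)%N (t.+1 == 3 * y)%N (t == 3 * y)%N
    (t == (3 * y).+1)%N (t == (3 * y).+2)%N (t == (3 * y).+3)%N
    (y + t == (2 * k).+1)%N (y + t == (2 * k).+2)%N
    false false false false false None.

(** The middle cell for odd [k], both middle cells for even [k]: the places of the new walls. *)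
Definition central (k y : nat) : bool := (k <= 2 * y <= k.+2)%N.

Lemma addb_gt0 (b b' : bool) : (0 < b + b')%N = b || b'. Proof. by case: b; case: b'. Qed.
Lemma addb_eq0 (b b' : bool) : (b + b' == 0)%N = ~~ b && ~~ b'. Proof. by case: b; case: b'. Qed.
Lemma addb_le1 (b b' : bool) : (b + b' <= 1)%N = ~~ b || ~~ b'. Proof. by case: b; case: b'. Qed.
Section wave_step.
Variables (k t y : nat) (n : pred cell -> nat).
Hypothesis yk : (0 < y <= k)%N.
Hypothesis n_fast : n fast = ((y.-1 == t) + ((y.+1 == t) && (y < k)))%N.
Hypothesis n_slow2 : n slow2 = ((t == 3 * y.-1) + ((t == 3 * y.+1) && (y < k)))%N.
Hypothesis n_back : n back =
  (((y.-1 + t == (2 * k).+1) && (1 < y)) + ((y.+1 + t == (2 * k).+1) && (y < k)))%N.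
Hypothesis n_nonwall : n nonwall = ((1 < y) + (y < k))%N.
Hypothesis n_scout : n scout = 0%N.

(** The slow signal obeys [t = 3y] and the returning one [y + t = 2k + 1]; they first share a cell
    or face each other at time [3k/2], in the middle. *)
Lemma wave_collides : (t <= (3 * k)./2)%N ->
  collides (wave k t y) n = (t == (3 * k)./2) && central k y.
Proof.
rewrite /collides n_back n_slow2 n_nonwall !addb_gt0 addb_eq0 /=.
clear - yk; have : (2 * (3 * k)./2 <= 3 * k <= (2 * (3 * k)./2).+1)%N by lia.
move: (3 * k)./2%N => h hk th; apply/idP/idP.
  by case/or4P; rewrite /central => H; lia.
rewrite /central=> H.
(* In turn: left middle cell, unique middle cell, right middle cell. For [k = 1] the fast signal
   meets the slow one before any [back] exists. *)
have: [|| 2 * y == k, 2 * y == k.+1 | 2 * y == k.+2]%N by lia.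
case/or3P => E; apply/or4P.
- by apply: Or43; lia.
- have [k1|k1] := boolP (k == 1)%N; [apply: Or42|apply: Or41]; lia.
- by apply: Or44; lia.
Qed.

Lemma wave_step : (t <= (3 * k)./2)%N -> ~~ ((t == (3 * k)./2) && central k y) ->
  cell_step (wave k t y) n false = wave k t.+1 y.
Proof.
move=> tk ncol; rewrite /cell_step wave_collides // (negbTE ncol) /=.
rewrite n_fast n_slow2 n_back n_nonwall n_scout !addb_gt0 addb_le1.
clear - yk tk ncol; rewrite /central in ncol; rewrite /wave; congr Cell;
  try (apply/idP/idP=> H; lia).
Qed.
End wave_step.

Lemma wall_step (q : cell) (n : pred cell -> nat) : wall q -> ~~ fired q ->
  cell_step q n false =
  if n nonwall == 0%N then fired_cell else wall_cell false (wait1 q) (wait2 q).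
Proof. by rewrite /cell_step => -> /negbTE ->. Qed.

(** The only traces that can survive the collision outside the middle; by [residue_step] they are
    gone after two steps. *)
Definition residue u1 u2 b1 :=
  Cell false false false false false false false u1 u2 false b1
       false false false false false None.

Lemma residue_step u1 u2 b1 (n : pred cell -> nat) :
  n fast = 0%N -> n slow2 = 0%N -> n back = 0%N -> n scout = 0%N ->
  cell_step (residue u1 u2 b1) n false = residue false u1 false.
Proof.
by move=> nf ns nb nm; rewrite /cell_step /collides /= nf ns nb nm.
Qed.

(** At this time the signals that the formula [wave] would let pass all lie in central cells, which
    are walls by now. *)
Lemma wave_residue (k y : nat) : (0 < y <= k)%N -> ~~ central k y ->
  wave k (3 * k)./2.+1 y =
  residue ((3 * k)./2.+1 == (3 * y).+2)%N ((3 * k)./2.+1 == (3 * y).+3)%N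
          (y + (3 * k)./2.+1 == (2 * k).+2)%N.
Proof.
rewrite /wave /residue /central => yk yc.
congr Cell; apply/negbTE/negP => H; lia.
Qed.

(** * Firing a segment by recursive halving *)

Section segment.
Variables (L : nat -> int -> option cell) (t0 : nat) (a : int) (k : nat).
Hypothesis law : line_law L.
Hypothesis ready : seg_ready L t0 a k.
Hypothesis k_gt0 : (0 < k)%N.

Let S t (y : nat) := L (t0 + t)%N (a + y%:Z)%R.

Let S_step t y : S t.+1 y.+1 =
  omap (fun q => cell_step q (count2 (S t y) (S t y.+2)) false) (S t y.+1).
Proof.
rewrite /S addnS law.
have -> : (a + y.+1%:Z - 1 = a + y%:Z)%R by lia.
by have -> : (a + y.+1%:Z + 1 = a + y.+2%:Z)%R by lia.
Qed.

Let S_stepP t y : (0 < y)%N -> S t.+1 y =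
  omap (fun q => cell_step q (count2 (S t y.-1) (S t y.+1)) false) (S t y).
Proof. by case: y => // y _; rewrite S_step. Qed.

(** The cell to the left of [a] is not controlled, hence the existential. It does not matter as long
    as cell 1 is a nonwall, since then the wall at [a] cannot fire. *)
Let S_step0 t : exists o, S t.+1 0 =
  omap (fun q => cell_step q (count2 o (S t 1)) false) (S t 0).
Proof.
exists (L (t0 + t)%N (a - 1)%R).
by rewrite /S addnS law !GRing.addr0.
Qed.

Let wallE (o o' : option cell) c1 c2 l :
  0 < count2 o o' nonwall ->
  cell_step (wall_cell c1 c2 l) (count2 o o') false = wall_cell false c1 c2.
Proof. by move=> h; rewrite wall_step // eqn0Ngt h. Qed.

Let far t := S t k.+1 = None \/ S t k.+1 = Some plain.

Let near_step t c1 c2 l : holds nonwall (S t 1) -> S t 0 = Some (wall_cell c1 c2 l) ->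
  S t.+1 0 = Some (wall_cell false c1 c2).
Proof.
move=> nw e; have [o ->] := S_step0 t; rewrite e /= wallE // /count2 nw.
by case: (holds _ _).
Qed.

Let far_step t : holds nonwall (S t k) -> far t -> far t.+1.
Proof.
rewrite /far S_step => nw [-> /=|-> /=]; [by left | right].
by rewrite wallE // /count2 nw.
Qed.

Let inv t :=
  [/\ S t 0 = Some (if t == 0%N then launch else plain),
      forall y, (0 < y <= k)%N -> S t y = Some (wave k t y) & far t].

Let inv_holds t y : inv t -> (y <= k.+1)%N ->
  [/\ holds fast (S t y) = (y == t) && (y <= k)%N,
      holds slow2 (S t y) = (t == 3 * y)%N && (y <= k)%N,
      holds back (S t y) = (y + t == (2 * k).+1)%N && (0 < y <= k)%N,
      holds nonwall (S t y) = (0 < y <= k)%N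
    & holds scout (S t y) = false].
Proof.
case=> h0 hk hf yk.
have [->|y0] := posnP y.
  by rewrite h0 andbF; case: t {h0 hk hf}.
have [ky|ky] := leqP y k.
  rewrite hk ?y0 ?ky //=.
  by split; rewrite ?andbT.
have -> : y = k.+1 by lia.
by case: hf => -> /=; rewrite ?ltnn ?andbF.
Qed.

Let inv0 : inv 0.
Proof.
case: ready => e0 ek ef; split; rewrite /S ?addn0 ?GRing.addr0 //.
- move=> y yk; rewrite ek //; congr Some; rewrite /wave /blank.
  by clear -yk; congr Cell; apply/esym/negbTE/negP => H; lia.
- by rewrite /far /S addn0.
Qed.

Let inv_n t y : inv t -> (0 < y <= k)%N ->
  let n := count2 (S t y.-1) (S t y.+1) in
  [/\ n fast = ((y.-1 == t) + ((y.+1 == t) && (y < k)))%N,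
      n slow2 = ((t == 3 * y.-1) + ((t == 3 * y.+1) && (y < k)))%N,
      n back = (((y.-1 + t == (2 * k).+1) && (1 < y)) + ((y.+1 + t == (2 * k).+1) && (y < k)))%N,
      n nonwall = ((1 < y) + (y < k))%N & n scout = 0%N].
Proof.
move=> iv yk; rewrite /count2.
have [||-> -> -> -> ->] := @inv_holds t y.-1 => //; first by clear -yk; lia.
have [||-> -> -> -> ->] := @inv_holds t y.+1 => //; first by clear -yk; lia.
clear - yk; have -> : (y.-1 <= k)%N by lia.
have -> : (0 < y.-1)%N = (1 < y)%N by lia.
by rewrite !andbT.
Qed.

Let inv_next t : (t <= (3 * k)./2)%N -> inv t ->
  [/\ S t.+1 0 = Some plain,
     forall y, (0 < y <= k)%N -> S t.+1 y =
       Some (if (t == (3 * k)./2) && central k y then wall_cell true false false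
             else wave k t.+1 y) & far t.+1].
Proof.
move=> tk iv; have [h0 hk hf] := iv; split.
- have [|_ _ _ nw _] := @inv_holds t 1%N iv; first by [].
  case: (t == 0%N) h0 => h0; apply: near_step h0; by rewrite nw k_gt0.
- move=> y yk; have [n1 n2 n3 n4 n5] := inv_n iv yk.
  have /andP[y0 _] := yk; rewrite S_stepP // (hk y yk) /=; congr Some.
  case: ifPn => c.
    rewrite /cell_step (@wave_collides k t y) // c //.
  by rewrite (@wave_step k t y).
- apply: far_step => //.
  have [|_ _ _ -> _] := @inv_holds t k iv => //; by rewrite k_gt0 leqnn.
Qed.

Let inv_all t : (t <= (3 * k)./2)%N -> inv t.
Proof.
elim: t => // t IH tk; have [h0 hk hf] := inv_next (ltnW tk) (IH (ltnW tk)).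
split=> // y yk; rewrite hk // ifN //.
by rewrite negb_and neq_ltn tk.
Qed.

Lemma segment_run t : (t <= (3 * k)./2)%N ->
  [/\ L (t0 + t)%N a = Some launch \/ L (t0 + t)%N a = Some plain,
      forall y : nat, (0 < y <= k)%N -> L (t0 + t)%N (a + y%:Z)%R = Some (wave k t y)
    & L (t0 + t)%N (a + k.+1%:Z)%R = None \/ L (t0 + t)%N (a + k.+1%:Z)%R = Some plain].
Proof.
case/inv_all; rewrite {1}/S GRing.addr0 => h0 hk hf; split=> //.
by rewrite h0; case: ifP; [left|right].
Qed.

Let quiet t (q : cell) (e1 e2 e3 : nat -> bool) :=
  [/\ S t 0 = Some plain,
      forall y, (0 < y <= k)%N -> S t y =
        Some (if central k y then q else residue (e1 y) (e2 y) (e3 y)) & far t].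

Lemma segment_split :
  [/\ L (t0 + (3 * k)./2.+1)%N a = Some plain,
      forall y : nat, (0 < y <= k)%N -> exists e1 e2 e3, L (t0 + (3 * k)./2.+1)%N (a + y%:Z)%R =
        Some (if central k y then wall_cell true false false else residue e1 e2 e3)
    & L (t0 + (3 * k)./2.+1)%N (a + k.+1%:Z)%R = None \/
      L (t0 + (3 * k)./2.+1)%N (a + k.+1%:Z)%R = Some plain].
Proof.
have [h0 hk hf] := inv_next (leqnn _) (inv_all (leqnn _)).
split=> //; first by move: h0; rewrite /S GRing.addr0.
move=> y yk; move: (hk y yk); rewrite eqxx /= /S => ->.
case: ifPn => c; first by exists false, false, false.
by rewrite wave_residue //; eexists; eexists; eexists.
Qed.

Let quiet_start : exists e1 e2 e3, quiet (3 * k)./2.+1 (wall_cell true false false) e1 e2 e3.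
Proof.
have [h0 hk hf] := inv_next (leqnn _) (inv_all (leqnn _)).
do 3 eexists; split=> // y yk; rewrite hk // eqxx /=; case: ifPn => // c.
by rewrite wave_residue //; congr (Some (residue _ _ _)).
Qed.

Hypothesis k_gt2 : (2 < k)%N.

Let quiet_holds t c1 c2 e1 e2 e3 y : quiet t (wall_cell c1 c2 false) e1 e2 e3 -> (y <= k.+1)%N ->
  [/\ holds fast (S t y) = false, holds slow2 (S t y) = false, holds back (S t y) = false,
      holds scout (S t y) = false & holds nonwall (S t y) = (0 < y <= k)%N && ~~ central k y].
Proof.
case=> h0 hk hf yk.
have [->|y0] := posnP y; first by rewrite h0.
have [ky|ky] := leqP y k.
  by rewrite hk ?y0 ?ky //=; case: ifP.
have -> : y = k.+1 by lia.
by case: hf => -> /=; rewrite ?ltnn ?andbF.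
Qed.

(** For [k > 2] the cells [1] and [k] are not central, so each wall, old or new, keeps a nonwall
    neighbour and does not fire during the wait. *)
Let quiet_step t c1 c2 e1 e2 e3 : quiet t (wall_cell c1 c2 false) e1 e2 e3 ->
  quiet t.+1 (wall_cell false c1 c2) (fun=> false) e1 (fun=> false).
Proof.
move=> qt; have [h0 hk hf] := qt; split.
- apply: near_step h0; have [|_ _ _ _ ->] := quiet_holds (y := 1%N) qt => //.
  by rewrite k_gt0 /central; clear -k_gt2; lia.
- move=> y yk.
  have [|a1 a2 a3 a4 a5] := quiet_holds (y := y.-1) qt => //; first by clear -yk; lia.
  have [|b1 b2 b3 b4 b5] := quiet_holds (y := y.+1) qt => //; first by clear -yk; lia.
  have /andP[y0 _] := yk; rewrite S_stepP // (hk y yk) /=; congr Some.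
  case: ifPn => c.
    rewrite wallE // /count2 a5 b5 addb_gt0.
    by move: c; rewrite /central; clear -yk k_gt2; lia.
  by rewrite residue_step // /count2 ?(a1, a2, a3, a4) ?(b1, b2, b3, b4).
- apply: far_step => //; have [|_ _ _ _ ->] := quiet_holds (y := k) qt => //.
  by rewrite k_gt0 leqnn /central; clear -k_gt2; lia.
Qed.

Lemma segment_relaunch i : (i <= 2)%N ->
  [/\ L (t0 + (3 * k)./2.+1 + i)%N a = Some plain,
      forall y : nat, (0 < y <= k)%N -> exists e1 e2 e3,
        L (t0 + (3 * k)./2.+1 + i)%N (a + y%:Z)%R =
        Some (if central k y then wall_cell (i == 0) (i == 1%N) (i == 2%N)
              else if i == 2%N then blank else residue e1 e2 e3)
    & L (t0 + (3 * k)./2.+1 + i)%N (a + k.+1%:Z)%R = None \/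
      L (t0 + (3 * k)./2.+1 + i)%N (a + k.+1%:Z)%R = Some plain].
Proof.
have [e1 [e2 [e3 q0]]] := quiet_start.
have q1 := quiet_step q0; have q2 := quiet_step q1.
case: i => [|[|[]]] // _; rewrite -addnA ?addn0 ?addn1 ?addn2.
- case: q0 => h0 hk hf; split=> //; first by move: h0; rewrite /S GRing.addr0.
  by move=> y yk; rewrite [L _ _]hk //; eexists; eexists; eexists.
- case: q1 => h0 hk hf; split=> //; first by move: h0; rewrite /S GRing.addr0.
  by move=> y yk; rewrite [L _ _]hk //; eexists; eexists; eexists.
- case: q2 => h0 hk hf; split=> //; first by move: h0; rewrite /S GRing.addr0.
  by move=> y yk; rewrite [L _ _]hk //; exists false, false, false.
Qed.
End segment.

Lemma cell_step_ext q n n' h : n =1 n' -> cell_step q n h = cell_step q n' h.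
Proof. by move=> e; rewrite /cell_step /collides !e. Qed.

Lemma mirror_law L (b : int) : line_law L -> line_law (fun t x => L t (b - x)%R).
Proof.
move=> law t x; rewrite law; have -> : (b - (x - 1) = b - x + 1)%R by lia.
have -> : (b - (x + 1) = b - x - 1)%R by lia.
case: (L t (b - x)%R) => //= q; congr Some.
by apply: cell_step_ext => P; rewrite /count2 addnC.
Qed.

(** [T] depends on [k] only, hence the two halves of a segment finish together.
    A cell fires one step after it and its neighbours have become walls. *)
Lemma seg_sync k : exists T, forall L t0 a, line_law L -> seg_ready L t0 a k ->
  (forall t (y : nat), (t <= T)%N -> (y <= k.+1)%N -> unfired (L (t0 + t)%N (a + y%:Z)%R)) /\
  (forall y : nat, (y <= k.+1)%N -> iswall (L (t0 + T)%N (a + y%:Z)%R)).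
Proof.
elim/ltn_ind: k => k IH.
have [k0|k0] := posnP k.
  exists 0%N => L t0 a _; rewrite k0 => -[h0 _ hf].
  have E (y : nat) : (y <= 1)%N ->
      [\/ L t0 (a + y%:Z)%R = Some launch, L t0 (a + y%:Z)%R = None
        | L t0 (a + y%:Z)%R = Some plain].
    case: y => [|[]] // _; first by rewrite GRing.addr0 h0; apply: Or31.
    by case: hf => ->; [apply: Or32|apply: Or33].
  split=> [t y|y]; rewrite ?leqn0.
    by move=> /eqP -> /E; rewrite addn0; case=> ->.
  by move=> /E; rewrite addn0; case=> ->.
have early L t0 a : line_law L -> seg_ready L t0 a k ->
    forall t (y : nat), (t <= (3 * k)./2)%N -> (y <= k.+1)%N -> unfired (L (t0 + t)%N (a + y%:Z)%R).
  move=> law rdy t y tk yk; have [h0 hk hf] := segment_run law rdy k0 tk.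
  have [->|y0] := posnP y; first by rewrite GRing.addr0; case: h0 => ->.
  have [ky|ky] := leqP y k; first by rewrite hk // y0.
  have -> : y = k.+1 by apply/eqP; rewrite eqn_leq yk.
  by case: hf => ->.
(* For [k <= 2] every cell is central, so the first collision fills the segment with walls. *)
have [k3|k3] := ltnP 2 k; last first.
  exists (3 * k)./2.+1 => L t0 a law rdy.
  have [h0 hk hf] := segment_split law rdy k0.
  have W (y : nat) : (y <= k.+1)%N -> iswall (L (t0 + (3 * k)./2.+1)%N (a + y%:Z)%R) /\
      unfired (L (t0 + (3 * k)./2.+1)%N (a + y%:Z)%R).
    move=> yk; have [->|y0] := posnP y; first by rewrite GRing.addr0 h0.
    have [ky|ky] := leqP y k; last first.
      have -> : y = k.+1 by apply/eqP; rewrite eqn_leq yk.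
      by case: hf => ->.
    have [|e1 [e2 [e3 ->]]] := hk y; first by rewrite y0.
    by rewrite ifT // /central; clear -k3 y0 ky; lia.
  split=> [t y|y yk]; last by have [] := W y yk.
  rewrite leq_eqVlt => /orP[/eqP-> yk|tk yk]; first by have [] := W y yk.
  exact: early tk yk.
have [|T' HT] := IH (k.-1)./2; first by clear -k3; lia.
exists ((3 * k)./2.+1 + 2 + T')%N => L t0 a law rdy.
set t2 := (t0 + (3 * k)./2.+1 + 2)%N.
have [h0 hk hf] := segment_relaunch law rdy k0 k3 (leqnn 2).
have rdyR : seg_ready L t2 (a + (k./2.+1)%:Z)%R (k.-1)./2.
  split.
  - have [|e1 [e2 [e3 ->]]] := hk k./2.+1; first by clear -k3; lia.
    by rewrite ifT // /central; clear -k3; lia.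
  - move=> y yk; have [|e1 [e2 [e3]]] := hk (k./2.+1 + y)%N; first by clear -k3 yk; lia.
    rewrite PoszD GRing.addrA => -> /=.
    by rewrite ifN // /central; clear -k3 yk; lia.
  - rewrite -GRing.addrA -PoszD; have -> : (k./2.+1 + (k.-1)./2.+1 = k.+1)%N by clear -k3; lia.
    exact: hf.
(* [b] is the left central cell. It launches towards [a]; the reflection exchanging [a] and [b]
   makes the left half a segment launched from its left end. *)
pose b := (a + (uphalf k)%:Z)%R.
have lawM := mirror_law (b + a)%R law.
have rdyM : seg_ready (fun t x => L t (b + a - x)%R) t2 a (k.-1)./2.
  split.
  - have -> : (b + a - a = a + (uphalf k)%:Z)%R by rewrite /b; lia.
    have [|e1 [e2 [e3 ->]]] := hk (uphalf k); first by clear -k3; lia.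
    by rewrite ifT // /central; clear -k3; lia.
  - move=> y yk.
    have -> : (b + a - (a + y%:Z) = a + (uphalf k - y)%N%:Z)%R by rewrite /b; clear -k3 yk; lia.
    have [|e1 [e2 [e3 ->]]] := hk (uphalf k - y)%N; first by clear -k3 yk; lia.
    by rewrite ifN // /central; clear -k3 yk; lia.
  - have -> : (b + a - (a + (k.-1)./2.+1%:Z) = a)%R by rewrite /b; clear -k3; lia.
    by right.
have [uR wR] := HT _ _ _ law rdyR.
have [uM wM] := HT _ _ _ lawM rdyM.
have cover (y : nat) : (y <= k.+1)%N ->
    (exists2 y', (y' <= (k.-1)./2.+1)%N & a + y%:Z = b + a - (a + y'%:Z))%R \/
    (exists2 y', (y' <= (k.-1)./2.+1)%N & a + y%:Z = a + (k./2.+1)%:Z + y'%:Z)%R.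
  move=> yk; have [c|c] := leqP y (uphalf k); [left|right].
    by exists (uphalf k - y)%N; rewrite /b; clear -yk c k3; lia.
  by exists (y - k./2.+1)%N; clear -yk c k3; lia.
have -> : (t0 + ((3 * k)./2.+1 + 2 + T') = t2 + T')%N by rewrite /t2; lia.
split=> [t y tT yk|y yk]; last first.
  by have [[y' y'k ->]|[y' y'k ->]] := cover y yk; [apply: wM|apply: wR].
have [t1|t1] := leqP t (3 * k)./2; first exact: early.
have [t3|t3] := leqP t ((3 * k)./2.+1 + 2).
  have [|h0' hk' hf'] := segment_relaunch (i := (t - (3 * k)./2.+1)%N) law rdy k0 k3.
    by clear -t3; lia.
  have E : (t0 + (3 * k)./2.+1 + (t - (3 * k)./2.+1) = t0 + t)%N by clear -t1; lia.
  move: h0' hk' hf'; rewrite E => h0' hk' hf'.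
  have [->|y0] := posnP y; first by rewrite GRing.addr0 h0'.
  have [ky|ky] := leqP y k; last first.
    have -> : y = k.+1 by apply/eqP; rewrite eqn_leq yk.
    by case: hf' => ->.
  have [|e1 [e2 [e3 ->]]] := hk' y; first by rewrite y0.
  by case: ifP => // _; case: ifP.
have -> : (t0 + t = t2 + (t - ((3 * k)./2.+1 + 2)))%N by rewrite /t2; clear -t3; lia.
by have [[y' y'k ->]|[y' y'k ->]] := cover y yk; [apply: uM|apply: uR] => //; clear -tT; lia.
Qed.

(** * Geometry of configurations *)

Definition oppdir (i : 'I_4) : 'I_4 := inord ((i + 2) %% 4).

Lemma ord4_ind (P : 'I_4 -> Prop) :
  P (inord 0) -> P (inord 1) -> P (inord 2) -> P (inord 3) -> forall i, P i.
Proof.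
move=> h0 h1 h2 h3 [[|[|[|[|//]]]] lti].
- by rewrite (_ : Ordinal _ = inord 0) //; apply: val_inj; rewrite /= inordK.
- by rewrite (_ : Ordinal _ = inord 1) //; apply: val_inj; rewrite /= inordK.
- by rewrite (_ : Ordinal _ = inord 2) //; apply: val_inj; rewrite /= inordK.
- by rewrite (_ : Ordinal _ = inord 3) //; apply: val_inj; rewrite /= inordK.
Qed.

Lemma val_oppdir i : val (oppdir i) = ((i + 2) %% 4)%N.
Proof. by rewrite /= inordK // ltn_pmod. Qed.

Lemma oppdirK : involutive oppdir.
Proof. by move=> i; apply: val_inj; rewrite !val_oppdir; case: i => i /=; lia. Qed.

Lemma eps_oppdirK p i : padd (padd p (eps i)) (eps (oppdir i)) = p.
Proof.
by case: p => a b; elim/ord4_ind: i; rewrite /padd /eps !val_oppdir /= !inordK //=;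
  congr pair; lia.
Qed.

Lemma padd_eps_inj p : injective (fun i => padd p (eps i)).
Proof.
move=> i j; case: p => a b; elim/ord4_ind: i; elim/ord4_ind: j;
  rewrite /padd /eps /= !inordK //= => -[]; lia.
Qed.

Lemma padd_eps_oppdir p q i : (padd p (eps i) == q) = (padd q (eps (oppdir i)) == p).
Proof.
apply/eqP/eqP => <-; first exact: eps_oppdirK.
by rewrite -{2}[i]oppdirK eps_oppdirK.
Qed.

Lemma adjacentP p q : reflect (exists i, padd p (eps i) = q) (adjacent p q).
Proof.
by apply: (iffP existsP) => -[i e]; exists i; rewrite -?(eqP e) ?e ?eqxx.
Qed.

Lemma adjacent_sym p q : adjacent p q = adjacent q p.
Proof.
apply/adjacentP/adjacentP => -[i <-]; exists (oppdir i); exact: eps_oppdirK.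
Qed.

Lemma adjacent_neq p q : adjacent p q -> p != q.
Proof.
case/adjacentP => i <-; case: p => a b; elim/ord4_ind: i;
  by rewrite /padd /eps /= !inordK //= xpair_eqE; apply/negP=> /andP[/eqP ? /eqP ?]; lia.
Qed.

Lemma config_rev c : is_config c -> is_config (rev c).
Proof.
case=> oc uc adj nadj; split; rewrite ?mem_rev ?rev_uniq // size_rev.
- move=> l lc; rewrite !nth_rev //; last by lia.
  rewrite adjacent_sym; have -> : (size c - l.+1 = (size c - l.+2).+1)%N by lia.
  by apply: adj; lia.
- move=> l m lc mc lm; rewrite !nth_rev // adjacent_sym.
  by apply: nadj; lia.
Qed.

(** The dynamics sees only the set of positions, so a configuration may be read in whichever
    direction is convenient. *)
Lemma state_rev (A : automaton) c t : @state A (rev c) t =1 @state A c t.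
Proof.
have e (d d' : seq pos) : d =i d' -> forall p, bc d p = bc d' p.
  by move=> dd p; apply: functional_extensionality => i; rewrite /bc dd.
elim: t => [|t IH] p /=; first by rewrite (e _ _ (mem_rev c)).
by rewrite /nbr !mem_rev !IH.
Qed.

Lemma fires_rev A c t : fires_at A (rev c) t -> fires_at A c t.
Proof.
case=> f1 f2; split.
  by move=> t' tt p pc; have := f1 t' tt p; rewrite mem_rev state_rev; apply.
by move=> p pc; have := f2 p; rewrite mem_rev state_rev; apply.
Qed.

Section config.
Variable c : seq pos.
Hypothesis cc : is_config c.
Let N := size c.
Let h := index origin c.

Lemma origin_lt : (h < N)%N. Proof. by rewrite index_mem; case: cc. Qed.
Lemma nth_origin : nth origin c h = origin. Proof. by rewrite nth_index //; case: cc. Qed.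
Lemma config_uniq : uniq c. Proof. by case: cc. Qed.

Lemma nth_config_eq k l : (k < N)%N -> (l < N)%N -> (nth origin c k == nth origin c l) = (k == l).
Proof. by move=> kN lN; rewrite nth_uniq //; case: cc. Qed.

Lemma config_adjacent k l : (k < N)%N -> (l < N)%N ->
  adjacent (nth origin c k) (nth origin c l) = (k == l.+1) || (l == k.+1).
Proof.
case: cc => _ uc adj nadj kN lN.
case: (ltngtP k l) => [kl|lk|->]; last first.
- rewrite [RHS](_ : _ = false); last by lia.
  by apply/negbTE/negP => /adjacent_neq; rewrite eqxx.
- rewrite adjacent_sym; have [e|ne] := eqVneq k l.+1; first by rewrite e adj // -e.
  by rewrite (negbTE (nadj _ _ lN kN _)) //; lia.
- have [e|ne] := eqVneq l k.+1; first by rewrite e adj // -?e ?orbT.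
  by rewrite (negbTE (nadj _ _ kN lN _)) //; lia.
Qed.

(** Nodes at distance at least 2 along the path are not adjacent, so a boundary condition records
    exactly the directions of predecessor and successor. *)
Lemma mem_neighbor k i : (k < N)%N ->
  (padd (nth origin c k) (eps i) \in c) =
  ((0 < k) && (padd (nth origin c k) (eps i) == nth origin c k.-1)) ||
  ((k.+1 < N) && (padd (nth origin c k) (eps i) == nth origin c k.+1)).
Proof.
move=> kN; apply/idP/idP; last first.
  by case/orP => /andP[hk /eqP->]; apply: mem_nth; rewrite -/N; lia.
move=> /(nthP origin)[l lN e].
have : adjacent (nth origin c k) (nth origin c l) by apply/adjacentP; exists i.
rewrite config_adjacent // => /orP[/eqP ek|/eqP el].
  by rewrite ek /= e ek eqxx.
by rewrite -el lN e eqxx orbT.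
Qed.

(** Reduces the plane to a line: counts over four directions become counts over two path
    neighbours. *)
Lemma sum_neighbors (F : pos -> nat) k : (k < N)%N ->
  (\sum_(i < 4) (if padd (nth origin c k) (eps i) \in c
                  then F (padd (nth origin c k) (eps i)) else 0)
   = (if 0 < k then F (nth origin c k.-1) else 0) +
     (if k.+1 < N then F (nth origin c k.+1) else 0))%N.
Proof.
move=> kN; set p := nth origin c k.
have one (q : pos) : adjacent p q ->
    (\sum_(i < 4) (if padd p (eps i) == q then F q else 0) = F q)%N.
  case/adjacentP => i <-; rewrite (bigD1 i) //= eqxx big1 ?addn0 // => j ji.
  by rewrite (inj_eq (@padd_eps_inj p)) (negbTE ji).
transitivity (\sum_(i < 4)
    ((if (0 < k) && (padd p (eps i) == nth origin c k.-1) then F (nth origin c k.-1) else 0) +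
     (if (k.+1 < N) && (padd p (eps i) == nth origin c k.+1)
      then F (nth origin c k.+1) else 0)))%N.
  apply: eq_bigr => i _; rewrite mem_neighbor // -/p.
  case: (boolP ((0 < k) && _)) => [/andP[k0 /eqP e]|_] /=; last first.
    by case: (boolP ((k.+1 < N) && _)) => [/andP[k0 /eqP e]|_] //=; rewrite e.
  (* Predecessor and successor are distinct, so no direction is counted twice. *)
  rewrite e; have -> : (k.+1 < N) && (nth origin c k.-1 == nth origin c k.+1) = false.
    by case: ltnP => //= k1; rewrite nth_config_eq; lia.
  by rewrite addn0.
rewrite big_split /=; congr addn.
- case: posnP => [_|k0] /=; first by rewrite big1.
  by apply: one; rewrite config_adjacent //; lia.
- case: ltnP => k1 /=; last by rewrite big1.
  by apply: one; rewrite config_adjacent //; lia.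
Qed.
End config.

(** * A solution *)

Definition pack4 T (n0 n1 n2 n3 : T) (i : 'I_4) : T :=
  match val i with 0 => n0 | 1 => n1 | 2 => n2 | _ => n3 end.

Lemma pack4E T (n : 'I_4 -> T) :
  pack4 (n (inord 0)) (n (inord 1)) (n (inord 2)) (n (inord 3)) = n.
Proof.
by apply: functional_extensionality; elim/ord4_ind; rewrite /pack4 /= inordK.
Qed.

Section make_automaton.
Variables (S : finType) (q0 : S) (F : {set S}) (init : ('I_4 -> bool) -> S)
  (next : S -> ('I_4 -> option S) -> S).
Hypothesis q0F : q0 \notin F.
Hypothesis next_q0 : forall n, (forall i, n i \in [:: None; Some q0]) -> next q0 n = q0.

Lemma make_stable (a0 a1 a2 a3 : option S) :
  a0 \in [:: None; Some q0] -> a1 \in [:: None; Some q0] ->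
  a2 \in [:: None; Some q0] -> a3 \in [:: None; Some q0] ->
  next q0 (pack4 a0 a1 a2 a3) = q0.
Proof.
by move=> h0 h1 h2 h3; apply: next_q0; elim/ord4_ind; rewrite /pack4 /= inordK.
Qed.

(** Every state is made a general state, so that the composite of [tau] and [Gst] can be an
    arbitrary map [init]. *)
Definition make_automaton : automaton :=
  @Automaton S q0 #|S| (@enum_val S predT) F (fun b => enum_rank (init b))
    (fun q a0 a1 a2 a3 => next q (pack4 a0 a1 a2 a3)) q0F make_stable.

Lemma make_state0 c p :
  @state make_automaton c 0 p = if p == origin then init (bc c origin) else q0.
Proof. by rewrite /= enum_rankK. Qed.

Lemma make_stateS c t p : @state make_automaton c t.+1 p =
  next (@state make_automaton c t p) (nbr c (@state make_automaton c t) p).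
Proof. by rewrite /= pack4E. Qed.
End make_automaton.

Definition aims_at (i : 'I_4) (o : option cell) : bool :=
  holds (fun q => aim q == Some (oppdir i)) o.

(** The general breaks the symmetry by choosing one occupied direction, where the scout starts. A
    general without neighbours is a wall at once and fires at the next step. *)
Definition cell_init (b : 'I_4 -> bool) : cell :=
  if [pick i | b i] is Some i then
    Cell false false false false false false false false false
         false false false false false false false (Some i)
  else plain.

Definition cell_next (q : cell) (n : 'I_4 -> option cell) : cell :=
  cell_step q (fun P => \sum_(i < 4) holds P (n i))%N [exists i, aims_at i (n i)].

Lemma blank_unfired : blank \notin [set q | fired q]. Proof. by rewrite inE. Qed.

Lemma cell_next_blank n : (forall i, n i \in [:: None; Some blank]) -> cell_next blank n = blank.
Proof.
move=> hn; have z (P : pred cell) : ~~ P blank -> (\sum_(i < 4) holds P (n i) = 0)%N.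
  by move=> hP; rewrite big1 // => i _; move: (hn i); rewrite !inE => /orP[] /eqP -> //=;
    rewrite (negbTE hP).
rewrite /cell_next /cell_step /collides /= !z //.
rewrite (_ : [exists i, _] = false) //; apply/negbTE/existsPn => i.
by move: (hn i); rewrite !inE => /orP[] /eqP -> .
Qed.

Definition squad : automaton := make_automaton cell_init blank_unfired cell_next_blank.

Definition scouting (b b1 : bool) : cell :=
  Cell false false false false false false false false false
       false false false false b b1 false None.

Lemma aim_step q n h : aim (cell_step q n h) = None.
Proof. by rewrite /cell_step; do 4?case: ifP. Qed.

Section squad_on.
Variable c : seq pos.
Hypothesis cc : is_config c.
Let N := size c.
Let h := index origin c.
Let st t k : cell := @state squad c t (nth origin c k).

Definition row t (x : int) : option cell :=
  match x with Posz k => if (k < N)%N then Some (st t k) else None | _ => None end.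

Lemma st_step t k : (k < N)%N -> st t.+1 k =
  cell_step (st t k) (count2 (row t (k%:Z - 1)%R) (row t (k%:Z + 1)%R))
   [exists i, aims_at i (nbr c (@state squad c t) (nth origin c k) i)].
Proof.
move=> kN; rewrite /st make_stateS /cell_next; apply: cell_step_ext => P.
pose F p := holds P (Some (@state squad c t p)) : nat.
transitivity (\sum_(i < 4) (if padd (nth origin c k) (eps i) \in c
                            then F (padd (nth origin c k) (eps i)) else 0))%N.
  by apply: eq_bigr => i _; rewrite /nbr; case: ifP.
rewrite sum_neighbors // /count2; congr addn.
- case: k kN => [|k] kN; first by [].
  rewrite (_ : (k.+1%:Z - 1 = k%:Z)%R); last by lia.
  by rewrite /= (ltnW kN).
- rewrite (_ : (k%:Z + 1 = k.+1%:Z)%R); last by lia.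
  by rewrite /=; case: ifP.
Qed.

Lemma aim_state t p : aim (@state squad c t.+1 p) = None.
Proof. by rewrite make_stateS aim_step. Qed.

Lemma row_law : line_law (fun t => row t.+1).
Proof.
move=> t [k|k] //=; case: ltnP => // kN /=; congr Some.
rewrite st_step // (_ : [exists i, _] = false) //; apply/negbTE/existsPn => i.
by rewrite /aims_at /nbr; case: ifP => //= _; rewrite aim_state.
Qed.

Lemma st_stepE t k : (k < N)%N -> st t.+1 k =
  cell_step (st t k)
   (fun P => ((0 < k)%N && P (st t k.-1)) + ((k.+1 < N)%N && P (st t k.+1)))%N
   [exists i, aims_at i (nbr c (@state squad c t) (nth origin c k) i)].
Proof.
move=> kN; rewrite st_step //; apply: cell_step_ext => P; rewrite /count2; congr addn.
- case: k kN => [|k] kN; first by [].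
  rewrite (_ : (k.+1%:Z - 1 = k%:Z)%R); last by lia.
  by rewrite /= (ltnW kN).
- rewrite (_ : (k%:Z + 1 = k.+1%:Z)%R); last by lia.
  by rewrite /=; case: ifP.
Qed.

Lemma squad_state0 k : (k < N)%N -> st 0 k = if k == h then cell_init (bc c origin) else blank.
Proof.
move=> kN; rewrite /st make_state0.
by rewrite -[X in _ == X](nth_origin cc) nth_config_eq // origin_lt.
Qed.

Section oriented.
Hypothesis hN : (h.+1 < N)%N.
Variable d : 'I_4.
Hypothesis dE : padd origin (eps d) = nth origin c h.+1.
Hypothesis pickE : [pick i | bc c origin i] = Some d.

Let aimed t k := [exists i, aims_at i (nbr c (@state squad c t) (nth origin c k) i)].

Let aimed0 k : (k < N)%N -> aimed 0 k = (k == h.+1).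
Proof.
move=> kN; apply/existsP/eqP.
  case=> i; rewrite /aims_at /nbr; case: ifP => //= ic.
  rewrite enum_rankK; case: ifP => [/eqP e|] //.
  rewrite /cell_init pickE /= => /eqP[di].
  apply/eqP; rewrite -(nth_config_eq cc kN hN) -dE di eq_sym.
  by rewrite -padd_eps_oppdir e.
move=> ->; exists (oppdir d).
have e : padd (nth origin c h.+1) (eps (oppdir d)) = origin by rewrite -dE eps_oppdirK.
rewrite /aims_at /nbr e ifT; last by case: cc.
by rewrite /= enum_rankK /cell_init pickE /= oppdirK.
Qed.

Let aimedS t k : aimed t.+1 k = false.
Proof.
apply/negbTE/existsPn => i.
by rewrite /aims_at /nbr; case: ifP => //= _; rewrite aim_state.
Qed.

(** Having aimed, the general carries the mark [scout1] at time 1 as if a scout had left it, which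
    sends the scout away from it. *)
Lemma scout_run t k : (h + t.+1 < N)%N -> (k < N)%N ->
  st t.+1 k = scouting (k == h + t.+1)%N (k.+1 == h + t.+1)%N.
Proof.
elim: t k => [|t IH] k tN kN.
  rewrite st_stepE // -/(aimed 0 k) aimed0 // squad_state0 //.
  have q0 (j : nat) P : (j < N)%N -> P blank = false ->
      P (cell_init (bc c origin)) = false -> P (st 0 j) = false.
    by move=> jN ? ?; rewrite squad_state0 //; case: ifP.
  rewrite /cell_init pickE in q0 *.
  set n := (fun P => _).
  have n0 P : P blank = false -> P (Cell false false false false false false false false false
       false false false false false false false (Some d)) = false -> n P = 0%N.
    move=> P1 P2; rewrite /n; case: posnP => k0 /=.
      by case: ltnP => k1 //=; rewrite q0.
    rewrite q0 //; last by clear -kN; lia.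
    by case: ltnP => k1 //=; rewrite q0.
  rewrite addn1 eqSS; case: (k == h); rewrite /cell_step /collides /= !n0 //=.
rewrite st_stepE // -/(aimed t.+1 k) aimedS IH //; last by clear -tN; lia.
set n := (fun P => _).
have nE P : n P = (((0 < k) && P (scouting (k.-1 == h + t.+1)%N (k.-1.+1 == h + t.+1)%N)) +
                  ((k.+1 < N) && P (scouting (k.+1 == h + t.+1)%N (k.+2 == h + t.+1)%N)))%N.
  rewrite /n; congr addn; congr nat_of_bool.
    by case: posnP => //= k0; rewrite IH //; clear -tN kN; lia.
  by case: ltnP => //= k0; rewrite IH //; clear -tN kN; lia.
rewrite /cell_step /collides /= !nE /= !andbF !andbT addb_le1 addb_gt0 ifN; last first.
  by clear -tN; apply/negP; lia.
by rewrite /scouting; congr Cell; clear -tN kN; lia.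
Qed.

Lemma scout_end t k : (h + t.+2 = N)%N -> (k < N)%N ->
  st t.+2 k = if k.+1 == N then launch else blank.
Proof.
move=> tN kN.
have run j : (j < N)%N -> st t.+1 j = scouting (j.+1 == N) (j.+2 == N)%N.
  by move=> jN; rewrite scout_run //; [congr scouting|]; clear -tN; lia.
rewrite st_stepE // -/(aimed t.+1 k) aimedS run //.
set n := (fun P => _).
have nE P : n P = (((0 < k) && P (scouting (k.-1.+1 == N) (k.-1.+2 == N)%N)) +
                  ((k.+1 < N) && P (scouting (k.+2 == N) (k.+3 == N)%N)))%N.
  rewrite /n; congr addn; congr nat_of_bool.
    by case: posnP => //= k0; rewrite run //; clear -tN kN; lia.
  by case: ltnP => //= k0; rewrite run //; clear -tN kN; lia.
rewrite /cell_step /collides /= !nE /= !andbF !andbT addb_le1 addb_gt0.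
have [e|e] := eqVneq k.+1 N; first by rewrite e ltnn orbT.
by rewrite /blank; congr Cell; clear -tN kN e; lia.
Qed.

Lemma squad_fires_oriented : exists t, fires_at squad c t.
Proof.
have [T HT] := seg_sync N.-1.
pose s := (N - h.+2)%N.
have sN : (h + s.+2 = N)%N by rewrite /s; clear -hN; lia.
(* The scout makes the last cell the launching wall, so the line is read backwards; the far end of
   the segment is then the missing cell of index [-1]. *)
have law := mirror_law (N.-1)%:Z row_law.
have N0 : (0 < N)%N by clear -hN; lia.
have rowE t k : (k < N)%N -> row t (N.-1%:Z - (0 + (N.-1 - k)%N%:Z))%R = Some (st t k).
  move=> kN; rewrite (_ : (_ - _ = k%:Z)%R); first by rewrite /= kN.
  by clear -kN; lia.
have ready : seg_ready (fun t x => row t.+1 (N.-1%:Z - x)%R) s.+1 0 N.-1.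
  split.
  - rewrite (_ : (N.-1%:Z - 0 = N.-1%:Z)%R); last by lia.
    rewrite /= ifT; last by clear -N0; lia.
    by rewrite scout_end // ?prednK ?eqxx.
  - move=> y yN; have := rowE s.+2 (N.-1 - y)%N.
    have -> : (N.-1 - (N.-1 - y) = y)%N by clear -yN; lia.
    move=> ->; last by clear -yN; lia.
    by rewrite scout_end ?ifN //; clear -yN; [apply/negP|]; lia.
  - left; rewrite (_ : (_ - _ = Negz 0)%R) //; clear -N0; lia.
have [un wl] := HT _ _ _ law ready.
have idx p : p \in c -> exists2 k, (k < N)%N & nth origin c k = p.
  by move/(nthP origin).
(* [s.+2] steps for the scout, [T] for the halving, and one for the walls to notice that their
   neighbours are walls. *)
exists (s.+2 + T).+1; split.
- move=> t tT p /idx[k kN <-]; rewrite inE -/(st t k).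
  have [ts|ts] := ltnP t s.+2; last first.
    have := un (t - s.+2)%N (N.-1 - k)%N; rewrite rowE //.
    have -> : (s.+1 + (t - s.+2)).+1 = t by clear -ts; lia.
    by apply; clear -tT ts kN; lia.
  case: t ts {tT} => [|t] ts; last first.
    by rewrite scout_run //; clear -ts sN; lia.
  by rewrite squad_state0 //; case: ifP => //; rewrite /cell_init pickE.
- move=> p /idx[k kN <-]; rewrite inE -/(st _ k).
  have wk j : (j < N)%N -> wall (st (s.+2 + T)%N j) && ~~ fired (st (s.+2 + T)%N j).
    move=> jN; have := un T (N.-1 - j)%N (leqnn _); have := wl (N.-1 - j)%N.
    rewrite rowE // addSn -addSn /iswall /unfired /= /nonwall negbK.
    by move=> -> //; [move=> -> //|]; clear -jN; lia.
  have /andP[w f] := wk k kN.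
  rewrite st_stepE // /cell_step (negbTE f) w ifT //.
  rewrite addn_eq0 /nonwall; apply/andP; split.
    have kN1 : (k.-1 < N)%N by clear -kN; lia.
    by case: posnP => //= k0; have /andP[-> _] := wk _ kN1.
  case: ltnP => //= k0; by have /andP[-> _] := wk k.+1 k0.
Qed.
End oriented.
End squad_on.

Lemma squad_solution : solution squad.
Proof.
move=> c cc; case ep : [pick i | bc c origin i] => [d|].
  have dc : bc c origin d by move: ep; case: pickP => // x hx [<-].
  move: (dc); rewrite /bc -{1}(nth_origin cc) mem_neighbor ?origin_lt //.
  (* The chosen direction leads to the successor or to the predecessor of the general; the second
     case is the first one for [rev c]. *)
  rewrite nth_origin // => /orP[|] /andP[h0 /eqP e]; last first.
    exact: (squad_fires_oriented cc h0 e ep).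
  have cr := config_rev cc.
  have ir : index origin (rev c) = (size c - (index origin c).+1)%N.
    apply/eqP; rewrite -(nth_config_eq cr) ?origin_lt ?size_rev //; last first.
      by have := origin_lt cc; lia.
    rewrite nth_origin // nth_rev; last by have := origin_lt cc; lia.
    by rewrite subnSK ?origin_lt // subKn ?nth_origin // ltnW // origin_lt.
  have bcr : bc (rev c) = bc c.
    apply: functional_extensionality => p; apply: functional_extensionality => i.
    by rewrite /bc mem_rev.
  have h1 : ((index origin (rev c)).+1 < size (rev c))%N.
    by rewrite ir size_rev; have := origin_lt cc; lia.
  have e1 : padd origin (eps d) = nth origin (rev c) (index origin (rev c)).+1.
    rewrite ir nth_rev; last by have := origin_lt cc; lia.
    by rewrite e; congr nth; have := origin_lt cc; lia.
  rewrite -bcr in ep; have [t ft] := squad_fires_oriented cr h1 e1 ep.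
  by exists t; apply: fires_rev.
(* No direction can be chosen: the general is the only node. *)
exists 1%N.
have one : size c = 1%N.
  have hN := origin_lt cc.
  apply/eqP; rewrite eqn_leq (leq_trans _ hN) // andbT leqNgt; apply/negP => N1.
  have [k [kN ak]] : exists k, (k < size c)%N /\ adjacent origin (nth origin c k).
    rewrite -{1}(nth_origin cc).
    have [h0|h0] := posnP (index origin c).
      by exists 1%N; rewrite config_adjacent // h0.
    exists (index origin c).-1; rewrite config_adjacent ?prednK ?eqxx //; last lia.
    by split=> //; lia.
  case/adjacentP: ak => i e; move: ep; case: pickP => // /(_ i).
  by rewrite /bc e mem_nth.
have init : cell_init (bc c origin) = plain by rewrite /cell_init ep.
have h0 : index origin c = 0%N by have := origin_lt cc; rewrite one; lia.
have idx p : p \in c -> nth origin c 0 = p.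
  by move/(nthP origin) => [k]; rewrite one; case: k.
split=> [[|//] _ p /idx <-|p /idx <-].
  by rewrite squad_state0 ?one // h0 /= inE init.
by rewrite st_stepE ?one // squad_state0 ?one // h0 /= init inE.
Qed.

(** * Configurations sharing a window with [c] *)

(** [d] is in W(r,j), up to orientation, for [n = j - r + 1]. *)
Definition agrees (c : seq pos) (n : nat) (d : seq pos) : Prop :=
  forall k, (k < n)%N -> nth origin c k \in d /\ bc d (nth origin c k) =1 bc c (nth origin c k).

Lemma agrees_rev c n d : agrees c n d -> agrees c n (rev d).
Proof.
move=> a k kn; have [h1 h2] := a k kn; rewrite mem_rev; split=> // i.
by rewrite -h2 /bc mem_rev.
Qed.

Lemma bc_step c k l : is_config c -> (k < size c)%N -> (l < size c)%N ->
  (l == k.+1) || (k == l.+1) ->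
  exists2 i, bc c (nth origin c k) i & padd (nth origin c k) (eps i) = nth origin c l.
Proof.
move=> cc kN lN kl.
have : adjacent (nth origin c k) (nth origin c l) by rewrite config_adjacent // orbC.
by case/adjacentP => i e; exists i; rewrite // /bc e mem_nth.
Qed.

(** The direction from one window node to the next leads to a node of [d]. It does not lead to the
    predecessor, which is already placed, so it leads to the successor: [d] follows [c] step by
    step. *)
Lemma agrees_prefix c n d : is_config c -> is_config d -> (n <= size c)%N ->
  nth origin d 0 = nth origin c 0 -> agrees c n d -> exists x, d = take n c ++ x.
Proof.
move=> cc cd nc e0 a; exists (drop n d).
have E k : (k < n)%N -> (k < size d)%N /\ nth origin d k = nth origin c k.
  elim/ltn_ind: k => -[|k] IH kn.
    by split=> //; have := origin_lt cd; case: (size d).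
  have [kd ek] := IH k (ltnSn k) (ltnW kn).
  have kc := leq_trans kn nc; have kc' := ltnW kc.
  have [|i bi ei] := bc_step (l := k.+1) cc kc' kc; first by rewrite eqxx.
  have [_ bk] := a k (ltnW kn).
  move: bi; rewrite -bk -ek /bc mem_neighbor // ek ei => /orP[] /andP[h /eqP e]; last by [].
  have [_ e'] := IH k.-1 (leq_ltn_trans (leq_pred k) (ltnSn k))
                         (leq_ltn_trans (leq_pred k) (ltnW kn)).
  move: e; rewrite e' => /eqP; rewrite nth_config_eq //; last exact: leq_ltn_trans (leq_pred k) kc'.
  by clear -h; lia.
rewrite -[LHS](cat_take_drop n d); congr (_ ++ _).
have nd : (n <= size d)%N.
  by case: n E {a nc} => // n E; have [] := E n (ltnSn n).
apply: (@eq_from_nth _ origin); first by rewrite !size_take_min; clear -nd nc; lia.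
move=> k; rewrite size_takel // => kn; rewrite !nth_take //.
by have [] := E k kn.
Qed.

(** An inner node has two neighbours and an end at most one, and boundary conditions show the
    difference. *)
Lemma endpoint_transfer c d k l : is_config c -> is_config d -> (k < size c)%N -> (l < size d)%N ->
  (k == 0%N) || (k.+1 == size c) -> nth origin d l = nth origin c k ->
  bc d (nth origin c k) =1 bc c (nth origin c k) -> (l == 0%N) || (l.+1 == size d).
Proof.
move=> cc cd kc ld kend e be; rewrite -[_ || _]negbK negb_or; apply/negP => /andP[l0 l1].
have l1d : (l.+1 < size d)%N by clear -l1 ld; lia.
have l2d : (l.-1 < size d)%N by clear -ld; lia.
have [|i bi ei] := bc_step (l := l.+1) cd ld l1d; first by rewrite eqxx.
have [|j bj ej] := bc_step (l := l.-1) cd ld l2d; first by clear -l0; lia.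
rewrite e be in bi ei; rewrite e be in bj ej.
have same : padd (nth origin c k) (eps i) = padd (nth origin c k) (eps j).
  move: bi bj; rewrite /bc !mem_neighbor //; case/orP: kend => /eqP ->; rewrite ?ltnn ?orbF //=.
    by move=> /andP[_ /eqP->] /andP[_ /eqP->].
  by move=> /andP[_ /eqP->] /andP[_ /eqP->].
move: same; rewrite ei ej => /eqP; rewrite nth_config_eq //.
by clear -l0; lia.
Qed.

Lemma agrees_oriented c n d : is_config c -> is_config d -> (0 < n <= size c)%N ->
  agrees c n d -> exists x, d = take n c ++ x \/ rev d = take n c ++ x.
Proof.
move=> cc cd /andP[n0 nc] a.
have [pd bp] := a 0%N n0; set p := nth origin c 0 in pd bp.
have kd : (index p d < size d)%N by rewrite index_mem.
have ek : nth origin d (index p d) = p by rewrite nth_index.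
case/orP: (endpoint_transfer cc cd (leq_trans n0 nc) kd isT ek bp) => /eqP k0.
  have [|x ->] := agrees_prefix cc cd nc _ a; first by rewrite -/p -ek k0.
  by exists x; left.
have [|x ->] := agrees_prefix cc (config_rev cd) nc _ (agrees_rev a).
  by rewrite nth_rev -?k0 // subn1 -/p -[RHS]ek.
by exists x; right.
Qed.

(** * Recognizing a window in time T *)

Section recognizer.
Variables (A : automaton) (c : seq pos) (n T : nat).

(** Components: the state of the backup solution [A]; whether [A] has fired; the
    clock, which is 0 in a sleeping node and otherwise [min(t, T + 1) + 1] at
    time [t]; the index of the node in the window [take n c], if known; the
    indices of the window nodes whose boundary condition is known to be that
    in [c]. *)
Definition rstate : finType := (St A * bool * 'I_T.+3 * option 'I_n * {set 'I_n})%type.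
Definition base (q : rstate) := q.1.1.1.1.
Definition latch (q : rstate) := q.1.1.1.2.
Definition clock (q : rstate) : nat := q.1.1.2.
Definition tag (q : rstate) := q.1.2.
Definition facts (q : rstate) := q.2.

Let y k := nth origin c k.

Definition rinit (b : 'I_4 -> bool) : rstate :=
  (@Gst A (@tau A b), false, inord 1, [pick k : 'I_n | y k == origin],
   [set k : 'I_n | (y k == origin) && [forall i, b i == bc c (y k) i]]).

Definition r_quiet : rstate := (@Qst A, false, ord0, None, set0).

Definition old_clock (q : rstate) (m : 'I_4 -> option rstate) : nat :=
  maxn (clock q) (\max_(i < 4) oapp clock 0%N (m i)).

(** A node finds its index from a neighbour that knows its own index [l] and from the direction [i]
    in which this neighbour lies. *)
Definition new_tag (q : rstate) (m : 'I_4 -> option rstate) : option 'I_n :=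
  if tag q is Some k then Some k else
  [pick k : 'I_n | [exists i, [exists l : 'I_n,
     (obind tag (m i) == Some l) && (padd (y l) (eps (oppdir i)) == y k)]]].

Definition rnext (q : rstate) (m : 'I_4 -> option rstate) : rstate :=
  let m' i := omap base (m i) in
  (@delta A (base q) (m' (inord 0)) (m' (inord 1)) (m' (inord 2)) (m' (inord 3)),
   latch q || (base q \in @Fst A),
   inord (if old_clock q m == 0%N then 0%N else minn (old_clock q m).+1 T.+2),
   new_tag q m,
   facts q :|: (\bigcup_(i < 4) oapp facts set0 (m i)) :|:
     [set k | (new_tag q m == Some k) && [forall i, isSome (m i) == bc c (y k) i]]).

Lemma rnextE q m :
  (base (rnext q m) = @delta A (base q) (omap base (m (inord 0))) (omap base (m (inord 1)))
                       (omap base (m (inord 2))) (omap base (m (inord 3)))) *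
  (latch (rnext q m) = latch q || (base q \in @Fst A)) *
  (clock (rnext q m) =
     if old_clock q m == 0%N then 0%N else minn (old_clock q m).+1 T.+2) *
  (tag (rnext q m) = new_tag q m) *
  (facts (rnext q m) = facts q :|: (\bigcup_(i < 4) oapp facts set0 (m i)) :|:
     [set k | (new_tag q m == Some k) && [forall i, isSome (m i) == bc c (y k) i]]).
Proof.
do !split; rewrite /clock /rnext /= inordK //.
by case: ifP => // _; rewrite ltnS geq_minr.
Qed.

(** Clock value [T.+1] means time exactly [T], and [T.+2] any later time; the verdict of [A] counts
    only then. *)
Definition r_fire : {set rstate} :=
  [set q : rstate | (clock q == T.+1) && (facts q == setT) ||
     (clock q == T.+2) && (latch q || (base q \in @Fst A))].

Lemma r_quiet_fire : r_quiet \notin r_fire.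
Proof. by rewrite inE. Qed.

Lemma rnext_quiet m : (forall i, m i \in [:: None; Some r_quiet]) -> rnext r_quiet m = r_quiet.
Proof.
move=> hm; rewrite /rnext.
have mE i : m i = None \/ m i = Some r_quiet.
  by move: (hm i); rewrite !inE => /orP[] /eqP; [left|right].
have b i : omap base (m i) \in [:: None; Some (@Qst A)].
  by case: (mE i) => ->; rewrite !inE // eqxx orbT.
have tq : new_tag r_quiet m = None.
  rewrite /new_tag /=; case: pickP => // k /existsP[i /existsP[l]].
  by case: (mE i) => ->.
have oc : old_clock r_quiet m = 0%N.
  by rewrite /old_clock /= max0n big1 // => i _; case: (mE i) => ->.
have fs : \bigcup_(i < 4) oapp facts set0 (m i) = set0.
  by rewrite big1 // => i _; case: (mE i) => ->.
rewrite Q_stable // tq oc fs /= /r_quiet !setU0 (negbTE (@Q_notin_F A)).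
by rewrite (_ : inord 0 = ord0) //; apply: val_inj; rewrite /= inordK.
Qed.

Definition recognizer : automaton := make_automaton rinit r_quiet_fire rnext_quiet.

Section on.
Variable d : seq pos.
Hypothesis cd : is_config d.
Let N := size d.
Let h := index origin d.
Let st t p : St recognizer := @state recognizer d t p.

Let st0 p : st 0 p = if p == origin then rinit (bc d origin) else r_quiet.
Proof. exact: make_state0. Qed.

Let stS t p : st t.+1 p = rnext (st t p) (nbr d (st t) p).
Proof. exact: make_stateS. Qed.

Lemma base_state t p : base (st t p) = @state A d t p.
Proof.
elim: t p => [|t IH] p; first by rewrite st0 /=; case: ifP.
rewrite stS rnextE IH.
have e i : omap base (nbr d (st t) p i) = nbr d (@state A d t) p i.
  by rewrite /nbr; case: ifP => //= _; rewrite IH.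
by rewrite !e.
Qed.

Lemma latchP t p : reflect (exists2 t', (t' < t)%N & @state A d t' p \in @Fst A) (latch (st t p)).
Proof.
apply: (iffP idP).
  elim: t => [|t IH]; first by rewrite st0; case: ifP.
  rewrite stS rnextE base_state => /orP[/IH[t' tt ft]|ft]; last by exists t.
  by exists t' => //; apply: ltnW.
elim: t => [|t IH] [t' // tt ft]; rewrite stS rnextE base_state.
move: tt; rewrite ltnS leq_eqVlt => /orP[/eqP <-|tt]; first by rewrite ft orbT.
by rewrite IH //; exists t'.
Qed.

Let dist k := ((k - h) + (h - k))%N.

Lemma clock_state t k : (k < N)%N ->
  clock (st t (nth origin d k)) = if (dist k <= t)%N then minn t.+1 T.+2 else 0%N.
Proof.
elim: t k => [|t IH] k kN.
  rewrite st0 -[X in _ == X](nth_origin cd) nth_config_eq // ?origin_lt // -/h /dist.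
  case: eqP => [->|kh]; first by rewrite subnn /clock /= inordK // !minnSS min0n.
  by rewrite ifN //; clear -kh; lia.
rewrite stS rnextE.
have oc : old_clock (st t (nth origin d k)) (nbr d (st t) (nth origin d k)) =
    if (dist k <= t.+1)%N then minn t.+1 T.+2 else 0%N.
  have up l : (l < N)%N -> (l == k) || (k == l.+1) || (l == k.+1) ->
     clock (st t (nth origin d l)) <= if (dist k <= t.+1)%N then minn t.+1 T.+2 else 0%N.
    move=> lN lk; rewrite IH //; case: ifP => // a; rewrite ifT //.
    by clear -a lk; rewrite /dist in a *; lia.
  apply/eqP; rewrite eqn_leq; apply/andP; split.
    rewrite /old_clock geq_max up ?eqxx //=; apply/bigmax_leqP => i _.
    rewrite /nbr; case: ifP => //=; rewrite mem_neighbor // => /orP[] /andP[a /eqP ->];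
      by apply: up; clear -a kN; rewrite -/N in kN *; lia.
  case: ifP => // dk; rewrite /old_clock leq_max.
  have [dk'|dk'] := leqP (dist k) t; first by rewrite IH // dk' leqnn.
  apply/orP; right.
  have [l lN lk] : exists2 l, (l < N)%N & ((k == l.+1) || (l == k.+1)) && (dist l <= t)%N.
    have := origin_lt cd; rewrite -/N -/h => hN.
    have [kh|kh] := leqP h k; [exists k.-1|exists k.+1]; clear IH; rewrite /dist in dk dk' *; lia.
  case/andP: lk => lk ld.
  have /adjacentP[i ei] : adjacent (nth origin d k) (nth origin d l) by rewrite config_adjacent.
  by apply: leq_trans (leq_bigmax i); rewrite /nbr ei mem_nth //= IH // ld leqnn.
rewrite oc; case: (dist k <= t.+1)%N => //=.
by rewrite ifN; clear; lia.
Qed.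

Lemma tag_sound t p k : p \in d -> tag (st t p) = Some k -> p = y k.
Proof.
elim: t p k => [|t IH] p k pd.
  rewrite st0; case: eqP => // ->; rewrite /tag /=.
  by case: pickP => // l /eqP e [<-].
rewrite stS rnextE /new_tag; case e : (tag _) => [l|].
  by move=> [<-]; exact: IH e.
case: pickP => // l /existsP[i /existsP[l' /andP[]]] + + [<-].
rewrite /nbr; case: ifP => //= qd /eqP tq /eqP <-.
by rewrite -(IH _ _ qd tq) eps_oppdirK.
Qed.

Lemma new_tag_sound t p k : p \in d -> new_tag (st t p) (nbr d (st t) p) = Some k -> p = y k.
Proof. by move=> pd e; apply: (@tag_sound t.+1) => //; rewrite stS rnextE. Qed.

(** A fact is created only at a node whose index is right by [tag_sound], after comparison with its
    actual neighbourhood; elsewhere it is copied. This holds in every configuration [d]. *)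
Lemma facts_sound t p (k : 'I_n) : p \in d -> k \in facts (st t p) ->
  y k \in d /\ bc d (y k) =1 bc c (y k).
Proof.
elim: t p => [|t IH] p pd.
  rewrite st0; case: eqP => [_|_]; last by rewrite inE.
  rewrite inE => /andP[/eqP -> /forallP b]; split; first by case: cd.
  by move=> i; apply/eqP.
rewrite stS rnextE !inE -!orbA => /or3P[/IH|/bigcupP[i _]|]; first exact.
  by rewrite /nbr; case: ifP => //= qd; [apply: IH | rewrite inE].
case/andP => /eqP tg /forallP b; rewrite -(new_tag_sound pd tg); split=> // i.
rewrite (new_tag_sound pd tg) -(eqP (b i)) -(new_tag_sound pd tg) /bc /nbr.
by case: ifP.
Qed.

Section complete.
Variable x : seq pos.
Hypothesis nc : (n <= size c)%N.
Hypothesis uc : uniq c.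
Hypothesis oy : origin \in take n c.
Hypothesis dE : d = take n c ++ x.
Hypothesis ag : agrees c n d.

Let yE k : (k < n)%N -> nth origin d k = y k.
Proof. by move=> kn; rewrite dE nth_cat size_takel // kn nth_take. Qed.

Let nN : (n <= N)%N.
Proof. by rewrite /N dE size_cat size_takel // leq_addr. Qed.

Let y_inj (k l : 'I_n) : y k = y l -> k = l.
Proof.
move=> /eqP; rewrite nth_uniq //; try exact: leq_trans (ltn_ord _) nc.
by move/eqP/val_inj.
Qed.

Let hn : (h < n)%N.
Proof.
rewrite /h dE index_cat oy; move: oy; rewrite -index_mem size_takel //.
Qed.

Lemma tag_complete t (k : 'I_n) : (dist k <= t)%N -> tag (st t (y k)) = Some k.
Proof.
elim: t k => [|t IH] k kt.
  have kh : k = h :> nat by move: kt; rewrite /dist; clear; lia.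
  have yo : y k = origin by rewrite -yE // kh /h nth_origin.
  rewrite st0 yo eqxx /tag /=; case: pickP => [l /eqP|/(_ k)]; last by rewrite yo eqxx.
  by rewrite -yo => /y_inj ->.
have ykd : y k \in d by rewrite -yE // mem_nth // (leq_trans _ nN).
have [dk|dk] := leqP (dist k) t; first by rewrite stS rnextE /new_tag IH.
have [l lk ld] : exists2 l : 'I_n, (k == l.+1 :> nat) || (l == k.+1 :> nat) & (dist l <= t)%N.
  have kn := ltn_ord k; move: dk kt; rewrite /dist.
  have [kh|kh] := leqP h k => dk kt.
    have ln : (k.-1 < n)%N by clear -kn; lia.
    by exists (Ordinal ln); clear -kh dk kt; rewrite /=; lia.
  have ln : (k.+1 < n)%N by apply: leq_ltn_trans kh hn.
  by exists (Ordinal ln); clear -kh dk kt; rewrite /=; lia.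
have /adjacentP[i ei] : adjacent (y k) (y l).
  by rewrite -!yE // config_adjacent // (leq_trans (ltn_ord _) nN).
have ld' : y l \in d by rewrite -yE // mem_nth // (leq_trans _ nN).
suff : isSome (tag (st t.+1 (y k))).
  case e : (tag _) => [m|] // _; congr Some; apply: y_inj.
  by rewrite -(tag_sound ykd e).
rewrite stS rnextE /new_tag; case: (tag _) => //; case: pickP => // /(_ k) /existsP[].
exists i; apply/existsP; exists l.
by rewrite /nbr ei ld' /= IH // eqxx -ei eps_oppdirK eqxx.
Qed.

(** The indices spread from the general at speed 1; fact [k] is born at time [dist k] and then
    travels at speed 1 itself. *)
Lemma facts_complete t (k : 'I_n) l : (l < N)%N ->
  (dist k + ((k - l) + (l - k)) <= t)%N -> k \in facts (st t (nth origin d l)).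
Proof.
move=> lN; move: {2}(_ + (l - k))%N (erefl ((k - l) + (l - k))%N) => m.
elim: m t l lN => [|m IH] t l lN ml; rewrite ml => kt.
  have lk : l = k :> nat by clear -ml; lia.
  rewrite lk yE //; rewrite addn0 in kt.
  have [ykd bk] := ag (ltn_ord k).
  case: t kt => [|t] kt.
    have kh : k = h :> nat by move: kt; rewrite /dist; clear; lia.
    have yo : y k = origin by rewrite -yE // kh /h nth_origin.
    rewrite st0 yo eqxx inE yo eqxx /=; apply/forallP => i.
    by rewrite -yo bk.
  rewrite stS rnextE !inE; apply/orP; right.
  have := tag_complete kt; rewrite stS rnextE => ->; rewrite eqxx /=.
  apply/forallP => i; rewrite -bk /nbr /bc.
  by case: ifP.
case: t kt => [|t] kt; first by move: kt; clear; lia.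
have [l' lN' ll] : exists2 l', (l' < N)%N &
   ((l == l'.+1) || (l' == l.+1)) && ((k - l') + (l' - k) == m)%N.
  have kN := leq_trans (ltn_ord k) nN.
  have [kl|kl] := leqP k l; [exists l.-1|exists l.+1]; clear IH kt; lia.
case/andP: ll => ll /eqP lm.
have /adjacentP[i ei] : adjacent (nth origin d l) (nth origin d l').
  by rewrite config_adjacent.
rewrite stS rnextE !inE; apply/orP; left; apply/orP; right.
apply/bigcupP; exists i => //; rewrite /nbr ei mem_nth //=.
by apply: IH => //; rewrite lm; move: kt; clear; lia.
Qed.
End complete.
End on.
End recognizer.

(** * Quiescence ahead of the first signal from the general *)

Lemma state_quiet (A : automaton) c t k : is_config c -> (k < size c)%N ->
  (t < (k - index origin c) + (index origin c - k))%N ->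
  @state A c t (nth origin c k) = @Qst A.
Proof.
move=> cc; elim: t k => [|t IH] k kN tk.
  rewrite /= -[X in _ == X](nth_origin cc) nth_config_eq // ?origin_lt // ifN //.
  by clear -tk; lia.
have q i : nbr c (@state A c t) (nth origin c k) i \in [:: None; Some (@Qst A)].
  rewrite /nbr; case: ifP => //; rewrite mem_neighbor // => /orP[] /andP[a /eqP ->];
    rewrite IH ?inE ?eqxx ?orbT //; clear -a kN tk; lia.
rewrite /= IH ?Q_stable //; clear -tk; lia.
Qed.

Lemma fires_dist A d t k : is_config d -> fires_at A d t -> (k < size d)%N ->
  ((k - index origin d) + (index origin d - k) <= t)%N.
Proof.
move=> cd [_ f] kN; rewrite leqNgt; apply/negP => /(state_quiet A cd kN) e.
have := f _ (mem_nth origin kN); by rewrite e (negbTE (@Q_notin_F A)).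
Qed.

(** * Firing time of the recognizer *)

Section upper.
Variables (A : automaton) (c : seq pos) (n T : nat).
Hypothesis sol : solution A.
Hypothesis cc : is_config c.
Hypothesis nc : (0 < n <= size c)%N.
Hypothesis oy : origin \in take n c.
(** With [h] the index of the general, the fact of the last window node is born at time [n - 1 - h]
    and takes [n - 1] steps to the first node. Likewise [total_T] lets the fact of the first node,
    born at time [h], reach the last node of every extension. *)
Hypothesis window_T : (2 * n <= T + (index origin c).+2)%N.
Hypothesis total_T : forall x, is_config (take n c ++ x) -> agrees c n (take n c ++ x) ->
  (index origin c + size (take n c ++ x) <= T.+1)%N.

Let R := recognizer A c n T.

Lemma recognizer_agrees x : is_config (take n c ++ x) -> agrees c n (take n c ++ x) ->
  fires_at R (take n c ++ x) T.
Proof.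
set d := take n c ++ x => cd ag.
have nc' : (n <= size c)%N by case/andP: nc.
have hE : index origin d = index origin c.
  by rewrite /d index_cat oy -{2}(cat_take_drop n c) index_cat oy.
have hn : (index origin d < n)%N.
  by rewrite /d index_cat oy; move: oy; rewrite -index_mem size_takel.
have nd : (n <= size d)%N by rewrite /d size_cat size_takel // leq_addr.
have tot := total_T cd ag; rewrite -/d in tot.
split=> [t tT|] p /(nthP origin)[k kN <-]; have {}kN : (k < size d)%N := kN.
- rewrite inE negb_or clock_state //.
  by case: ifP => // _; apply/andP; split; apply/nandP; left; clear -tT; lia.
- rewrite /R inE clock_state // ifT; last first.
    by clear -tot kN hE hn nd; rewrite hE in hn *; lia.
  have -> : minn T.+1 T.+2 = T.+1 by clear; lia.
  rewrite eqxx /=; apply/orP; left; apply/eqP/setP => j; rewrite inE.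
  apply: (@facts_complete A c n T d cd x nc' (config_uniq cc) oy (erefl _) ag T j k kN).
  have := ltn_ord j; rewrite hE in hn *; move: window_T; clear -tot kN hn nd; lia.
Qed.

Lemma recognizer_fires d : is_config d -> exists t, fires_at R d t.
Proof.
move=> cd; have [ag|nag] := classic (agrees c n d).
  have [x [dE|dE]] := agrees_oriented cc cd nc ag.
    by exists T; rewrite dE; apply: recognizer_agrees; rewrite -dE.
  exists T; apply: fires_rev; rewrite dE; apply: recognizer_agrees; rewrite -dE.
    exact: config_rev.
  exact: agrees_rev.
(* No node ever holds all facts here; an early verdict of [A] is latched until time [T.+1]. *)
have [t0 ft] := sol cd; exists (maxn t0 T.+1).
have notfull t p : p \in d -> (facts (@state R d t p) == setT) = false.
  move=> pd; apply/eqP => e; apply: nag => k kn.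
  by apply: (@facts_sound A c n T d cd t p (Ordinal kn)); rewrite // e inE.
have [f1 f2] := ft.
split=> [t tT|] p pd; have /(nthP origin)[k kN ek] := pd.
- rewrite inE notfull // andbF /= base_state; apply/nandP; rewrite -ek clock_state //.
  have [tT'|tT'] := ltnP t T.+1; first by left; case: ifP => //; clear -tT'; lia.
  right; rewrite ek; have tt : (t < t0)%N by clear -tT tT'; lia.
  rewrite negb_or f1 // andbT; apply/negP => /latchP[t' t't].
  by rewrite (negbTE (f1 t' (ltn_trans t't tt) p pd)).
(* All clocks run by now: at time [t0] every node fires under [A], hence has been reached by a
   signal. *)
- rewrite inE notfull // andbF /= base_state -ek clock_state // ifT; last first.
    by have := fires_dist cd ft kN; clear; lia.
  rewrite ek (_ : _ == _) /=; last by clear; lia.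
  apply/orP; have [e|e] := leqP t0 T.
    left; apply/latchP; exists t0; last exact: f2.
    by clear -e; lia.
  by right; rewrite (maxn_idPl e) f2.
Qed.
End upper.

(** * Propagation of information *)

Lemma index_origin_mid (x0 y x1 : seq pos) : uniq (x0 ++ y ++ x1) -> origin \in y ->
  index origin (x0 ++ y ++ x1) = (size x0 + index origin y)%N.
Proof.
rewrite cat_uniq => /and3P[_ /hasPn nh _] oy.
rewrite index_cat ifN ?index_cat ?oy //.
by apply: nh; rewrite mem_cat oy.
Qed.

Lemma nth_mid (x0 y x1 : seq pos) k : (k < size y)%N ->
  nth origin (x0 ++ y ++ x1) (size x0 + k) = nth origin y k.
Proof. by move=> ky; rewrite nth_cat -ltn_subRL subnn ltn0 addKn nth_cat ky. Qed.

(** Such a [q] is next to the first or the last node of [y], so [k] is an end index and both bounds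
    say that no signal has reached [q]. They are written for general [k] to fit the induction of
    [light_cone]. *)
Lemma outside_quiet A x0 y x1 t k q : is_config (x0 ++ y ++ x1) -> origin \in y ->
  (k < size y)%N -> q \in x0 ++ y ++ x1 -> q \notin y -> adjacent (nth origin y k) q ->
  (x0 = [::] \/ t < k + index origin y + 1)%N ->
  (x1 = [::] \/ t.+1 + k + index origin y < 2 * size y)%N ->
  @state A (x0 ++ y ++ x1) t q = @Qst A.
Proof.
move=> cc oy ky qc qy aq hA hB.
have /(nthP origin)[l lN el] := qc.
have hE := index_origin_mid (config_uniq cc) oy.
have iy : (index origin y < size y)%N by rewrite index_mem.
move: lN; rewrite !size_cat => lN.
rewrite -el in aq qy *; rewrite -(nth_mid x0 x1 ky) config_adjacent ?size_cat // in aq; last first.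
  by clear -ky; lia.
have lout : (l < size x0)%N || (size x0 + size y <= l)%N.
  have [//|l1] := ltnP l (size x0); have [//|l2] := leqP (size x0 + size y)%N l.
  case/negP: qy.
  have -> : l = (size x0 + (l - size x0))%N by clear -l1; lia.
  have ly : (l - size x0 < size y)%N by clear -l1 l2; lia.
  by rewrite nth_mid // mem_nth.
apply: state_quiet => //; rewrite ?size_cat // hE.
case/orP: lout => lout.
  case: hA => [x00|hA]; first by rewrite x00 in lout.
  by clear -hA lout aq; lia.
case: hB => [x10|hB]; first by move: lN; rewrite x10 addn0 ltnNge lout.
by clear -hB lout aq ky; lia.
Qed.

Lemma stateS A c t p : @state A c t.+1 p =
  @delta A (@state A c t p) (nbr c (@state A c t) p (inord 0)) (nbr c (@state A c t) p (inord 1))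
    (nbr c (@state A c t) p (inord 2)) (nbr c (@state A c t) p (inord 3)).
Proof. by []. Qed.

(** News of the node before [y_0] needs [index origin y + 1] steps to be awakened
    and [k + 1] more to reach [y_k]; symmetrically on the right. *)
Lemma light_cone A x0 y x1 x0' x1' t k :
  is_config (x0 ++ y ++ x1) -> is_config (x0' ++ y ++ x1') -> origin \in y ->
  (forall p, p \in y -> bc (x0 ++ y ++ x1) p =1 bc (x0' ++ y ++ x1') p) -> (k < size y)%N ->
  ((x0 = [::] /\ x0' = [::]) \/ t < k + index origin y + 2)%N ->
  ((x1 = [::] /\ x1' = [::]) \/ t + k + index origin y < 2 * size y)%N ->
  @state A (x0 ++ y ++ x1) t (nth origin y k) = @state A (x0' ++ y ++ x1') t (nth origin y k).
Proof.
move=> c1 c2 oy bcE; elim: t k => [|t IH] k ky hA hB.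
  rewrite /=; case: ifP => // _.
  by rewrite (_ : bc _ origin = bc (x0' ++ y ++ x1') origin) //;
    apply: functional_extensionality => i; apply: bcE.
have own : @state A (x0 ++ y ++ x1) t (nth origin y k) =
           @state A (x0' ++ y ++ x1') t (nth origin y k).
  apply: IH => //; [case: hA => hA|case: hB => hB]; [by left| |by left|]; right; lia.
have nb i : nbr (x0 ++ y ++ x1) (@state A (x0 ++ y ++ x1) t) (nth origin y k) i =
            nbr (x0' ++ y ++ x1') (@state A (x0' ++ y ++ x1') t) (nth origin y k) i.
  have := bcE _ (mem_nth origin ky) i; rewrite /nbr /bc => e; rewrite -e.
  case: ifP => // q1; have q2 := q1; rewrite e in q2; congr Some.
  have aq : adjacent (nth origin y k) (padd (nth origin y k) (eps i)) by apply/adjacentP; exists i.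
  have [qy|qy] := boolP (padd (nth origin y k) (eps i) \in y); last first.
    rewrite !(@outside_quiet _ _ y _ _ k) //.
    - by case: hA => [[_ ->]|hA]; [left|right; clear -hA; lia].
    - by case: hB => [[_ ->]|hB]; [left|right; clear -hB; lia].
    - by case: hA => [[-> _]|hA]; [left|right; clear -hA; lia].
    - by case: hB => [[-> _]|hB]; [left|right; clear -hB; lia].
  have /(nthP origin)[l ly el] := qy; have {}ly : (l < size y)%N := ly.
  rewrite -el in aq *; rewrite -(nth_mid x0 x1 ky) -(nth_mid x0 x1 ly) in aq.
  rewrite config_adjacent // ?size_cat in aq; try (clear -ky ly; lia).
  apply: IH => //.
    by case: hA => hA; [left|right; clear -hA aq; lia].
  by case: hB => hB; [left|right; clear -hB aq; lia].
rewrite !stateS.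
by rewrite own !nb.
Qed.

(** The states must agree up to time [t], not only at [t]: [d] might otherwise
    have fired earlier. *)
Lemma fires_transfer A c d t p : solution A -> is_config d -> p \in c -> p \in d ->
  (forall t', (t' <= t)%N -> @state A c t' p = @state A d t' p) ->
  fires_at A c t -> fires_at A d t.
Proof.
move=> sol cd pc pd e [c1 c2].
have [t0 [d1 d2]] := sol d cd.
have le : (t0 <= t)%N.
  by rewrite leqNgt; apply/negP => /d1/(_ p pd); rewrite -e // c2.
suff -> : t = t0 by [].
apply/eqP; rewrite eqn_leq le andbT leqNgt; apply/negP => lt.
by have := c1 t0 lt p pc; rewrite e // d2.
Qed.

(** News of the first node reaches the last one only at time [size c + index origin c - 1]. Until
    then the last node behaves as in an extension with [x0] longer than [t], whose far end is still
    asleep. *)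
Lemma long_left_not_fires A c t : is_config c -> solution A -> (0 < index origin c)%N ->
  (t < size c + index origin c - 1)%N ->
  (forall M, exists x0, [/\ (M < size x0)%N, is_config (x0 ++ behead c) &
     forall p, p \in behead c -> bc (x0 ++ behead c) p =1 bc c p]) ->
  ~ fires_at A c t.
Proof.
case: c => [|p0 y]; first by [].
rewrite /=; case: eqP => //= p0o cc sol _ tN long ft.
have [x0 [tx0 c2 bcE]] := long t.
have oy : origin \in y by case: cc => + _ _ _; rewrite inE eq_sym; case: eqP p0o.
have c1 : is_config ([:: p0] ++ y ++ [::]) by rewrite cats0.
have c2' : is_config (x0 ++ y ++ [::]) by rewrite cats0.
have iy : (index origin y < size y)%N by rewrite index_mem.
have last_y : ((size y).-1 < size y)%N by clear -iy; lia.
have ft2 : fires_at A (x0 ++ y) t.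
  apply: (@fires_transfer _ (p0 :: y) _ _ (nth origin y (size y).-1)) ft => //.
  - by rewrite inE mem_nth ?orbT.
  - by rewrite mem_cat mem_nth ?orbT.
  move=> t' tt; have := @light_cone A [:: p0] y [::] x0 [::] t' (size y).-1 c1 c2' oy.
  rewrite /= !cats0; apply=> //; last by left.
    by move=> p py i; rewrite bcE.
  by right; clear -tN tt iy; lia.
have x00 : (0 < size (x0 ++ y))%N by rewrite size_cat; clear -tx0; lia.
have := fires_dist c2 ft2 x00.
have := index_origin_mid (config_uniq c2') oy; rewrite cats0 => ->.
by clear -tx0; lia.
Qed.

(** The right-hand side does not mention [a]: past the first node of [z], different left extensions
    look alike. *)
Lemma bc_tail a z k i : is_config (a ++ z) -> (0 < k < size z)%N ->
  bc (a ++ z) (nth origin z k) i =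
  (padd (nth origin z k) (eps i) == nth origin z k.-1) ||
  ((k.+1 < size z)%N && (padd (nth origin z k) (eps i) == nth origin z k.+1)).
Proof.
move=> cc /andP[k0 kz].
have nz m : (m < size z)%N -> nth origin (a ++ z) (size a + m) = nth origin z m.
  by move=> _; rewrite nth_cat -ltn_subRL subnn ltn0 addKn.
rewrite -[in LHS](nz k kz) /bc mem_neighbor ?size_cat ?ltn_add2l //.
have -> : ((size a + k).-1 = size a + k.-1)%N by clear -k0; lia.
rewrite -addnS ltn_add2l nz // nz; last by clear -kz; lia.
rewrite addn_gt0 k0 orbT /=; congr orb; case: ltnP => //= k1.
by rewrite nz.
Qed.

(** * Extensions *)

Section sup.
Variable P : nat -> Prop.

Lemma sup_nat_exists : (exists n, P n) -> exists v, sup_nat P v.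
Proof.
case=> n0 Pn0; have [unb|bnd] := classic (forall n, exists m, P m /\ (n < m)%N).
  by exists None.
have [M hM] : exists M, forall m, P m -> (m <= M)%N.
  apply: NNPP => no; apply: bnd => n; apply: NNPP => no'; apply: no; exists n => m Pm.
  by rewrite leqNgt; apply/negP => nm; apply: no'; exists m.
elim: M hM => [|M IH] hM.
  by exists (Some n0); split=> // m /hM; rewrite leqn0 => /eqP ->.
have [PM|nPM] := classic (P M.+1); first by exists (Some M.+1).
apply: IH => m Pm; have := hM m Pm; rewrite leq_eqVlt => /orP[/eqP e|//].
by rewrite e in Pm.
Qed.

Lemma sup_nat_epsilon : (exists n, P n) -> sup_nat P (epsilon (inhabits None) (sup_nat P)).
Proof. by move/sup_nat_exists; exact: epsilon_spec. Qed.
End sup.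

(** A finite list holding every path of length at most [m] from [p]; it turns a bound on lengths
    into finiteness of [W]. *)
Fixpoint walks (p : pos) (m : nat) : seq (seq pos) :=
  [::] :: (if m is m'.+1 then
    flatten [seq [seq q :: w | w <- walks q m'] | q <- [seq padd p (eps i) | i <- enum 'I_4]]
  else [::]).

Lemma mem_walks p m w : path adjacent p w -> (size w <= m)%N -> w \in walks p m.
Proof.
elim: m p w => [|m IH] p [|q w] //= /andP[/adjacentP[i e] pw] sw.
rewrite inE /=; apply/flatten_mapP; exists q.
  by apply/mapP; exists i; rewrite ?mem_enum.
by apply/mapP; exists w => //; apply: IH.
Qed.

Lemma config_path a p w : is_config (a ++ p :: w) -> path adjacent p w.
Proof.
elim: w a p => [|q w IH] a p //= cc; rewrite (IH (rcons a p)) ?cat_rcons // andbT.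
have := @config_adjacent _ cc (size a) (size a).+1; rewrite eqxx orbT.
have -> : nth origin (a ++ [:: p, q & w]) (size a) = p by rewrite nth_cat ltnn subnn.
have -> : nth origin (a ++ [:: p, q & w]) (size a).+1 = q.
  by rewrite nth_cat ltnNge leqnSn subSnn.
by apply; rewrite size_cat /=; clear; lia.
Qed.

Section translate.
Variable c : seq pos.
Hypothesis cc : is_config c.
Let h := index origin c.

Lemma r_ofE : r_of c = (- h%:Z)%R. Proof. by []. Qed.
Lemma s_ofE : s_of c = ((size c - h).-1)%:Z%R.
Proof. by have := origin_lt cc; rewrite /s_of -/h; lia. Qed.

Lemma seg_r (j : nat) : seg c (r_of c) j%:Z = take (h + j).+1 c.
Proof.
by rewrite /seg subrr drop0 r_ofE; congr take; lia.
Qed.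

Lemma seg_r1 (j : nat) : seg c (r_of c + 1)%R j%:Z = take (h + j) (behead c).
Proof.
rewrite /seg r_ofE (_ : absz _ = h + j)%N; last by lia.
by rewrite (_ : absz _ = 1)%N ?drop1 //; lia.
Qed.

Lemma pt_nth (k : nat) : pt c (k%:Z - h%:Z)%R = nth origin c k.
Proof. by rewrite /pt r_ofE; congr nth; lia. Qed.

Lemma W_r (j : nat) x0 x1 : W c (r_of c) j%:Z x0 x1 <->
  is_config (x0 ++ take (h + j).+1 c ++ x1) /\
  forall k, (k < (h + j).+1)%N ->
    bc (x0 ++ take (h + j).+1 c ++ x1) (nth origin c k) =1 bc c (nth origin c k).
Proof.
rewrite /W seg_r r_ofE; split=> -[c' b]; split=> //.
  by move=> k kn; rewrite -pt_nth; apply: b; lia.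
move=> l lj; have -> : l = ((absz (l + h%:Z))%:Z - h%:Z)%R by lia.
by rewrite pt_nth; apply: b; lia.
Qed.

Lemma W_r1 (j : nat) x0 x1 : W c (r_of c + 1)%R j%:Z x0 x1 <->
  is_config (x0 ++ take (h + j) (behead c) ++ x1) /\
  forall k, (0 < k < (h + j).+1)%N ->
    bc (x0 ++ take (h + j) (behead c) ++ x1) (nth origin c k) =1 bc c (nth origin c k).
Proof.
rewrite /W seg_r1 r_ofE; split=> -[c' b]; split=> //.
  by move=> k kn; rewrite -pt_nth; apply: b; lia.
move=> l lj; have -> : l = ((absz (l + h%:Z))%:Z - h%:Z)%R by lia.
by rewrite pt_nth; apply: b; lia.
Qed.

Lemma W_r_agrees (j : nat) x1 : (h + j < size c)%N -> W c (r_of c) j%:Z [::] x1 <->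
  is_config (take (h + j).+1 c ++ x1) /\ agrees c (h + j).+1 (take (h + j).+1 c ++ x1).
Proof.
move=> hj; split; first case/W_r; rewrite /agrees => c' b.
  split=> // k kn; split; last exact: b.
  by rewrite mem_cat -(nth_take origin kn) mem_nth // size_takel.
by apply/W_r; split=> [|k kn]; [case: c' | have [_ /(_ k kn)[]] := c'].
Qed.

(** In the excluded case [r = j = 0], [x1] empty, a single neighbour of the general
    may as well be continued on the left. *)
Lemma W_r_left (j : nat) x0 x1 : (h + j < size c)%N -> (0 < h + j + size x1)%N ->
  W c (r_of c) j%:Z x0 x1 -> x0 = [::].
Proof.
move=> hj hx /W_r[c' b]; apply/eqP; rewrite -size_eq0.
have c0 : (0 < size c)%N by clear -hj; lia.
have ns : size (take (h + j).+1 c) = (h + j).+1 by rewrite size_takel.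
have e : nth origin (x0 ++ take (h + j).+1 c ++ x1) (size x0) = nth origin c 0.
  by rewrite -[size x0]addn0 nth_mid ?ns // nth_take.
have := endpoint_transfer cc c' c0 _ _ e (b 0%N _); rewrite !size_cat ns => /(_ _ _ _)/orP[]//.
all: by clear -hx; lia.
Qed.

(** A node after [p_s] would lie in a direction that the boundary condition of [p_s] reserves for
    nodes of [c], and so would occur twice. *)
Lemma W_r_right (x0 x1 : seq pos) : W c (r_of c) (s_of c) x0 x1 -> x1 = [::].
Proof.
have hN := origin_lt cc; rewrite -/h in hN.
rewrite s_ofE => /W_r; rewrite (_ : (h + (size c - h).-1).+1 = size c)%N; last by clear -hN; lia.
rewrite take_size => -[c' b].
case: x1 c' b => // q x1 c' b.
have l0 : ((size c).-1 < size c)%N by clear -hN; lia.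
have [c1 c2] : (size x0 + (size c).-1 < size (x0 ++ c ++ q :: x1))%N /\
      (size x0 + size c < size (x0 ++ c ++ q :: x1))%N.
  by rewrite !size_cat /=; clear -hN; lia.
have [|i bi ei] := bc_step c' c1 c2; first by clear -hN; lia.
have eq : nth origin (x0 ++ c ++ q :: x1) (size x0 + size c) = q.
  by rewrite catA nth_cat size_cat ltnn subnn.
rewrite nth_mid // eq in bi ei; rewrite b // /bc ei in bi.
by move: (config_uniq c'); rewrite !cat_uniq /= bi !(andbF, orbT).
Qed.

Lemma V_nonempty (j : nat) : (h + j < size c)%N -> W c (r_of c) j%:Z [::] (drop (h + j).+1 c).
Proof.
by move=> hj; apply/W_r; rewrite /= cat_take_drop; split.
Qed.

Lemma g_spec (j : nat) : (h + j < size c)%N ->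
  sup_nat (fun n => exists x1, V c (r_of c) j%:Z x1 /\ size x1 = n) (g c (r_of c) j%:Z).
Proof.
move=> hj; apply: sup_nat_epsilon; exists (size (drop (h + j).+1 c)), (drop (h + j).+1 c).
by split=> //; exists [::]; apply: V_nonempty.
Qed.

(** Makes [s] a candidate for [j_0] whenever [-r <= s]. *)
Lemma g_end : g c (r_of c) (s_of c) = Some 0%N.
Proof.
have hN := origin_lt cc; rewrite -/h in hN.
have := @g_spec (size c - h).-1; rewrite -s_ofE => /(_ _); case: (g _ _ _) => [m|] H.
  have [|[x1 [[x0 w] <-]] _] := H; first by clear -hN; lia.
  by rewrite (W_r_right w).
have [|m [[x1 [[x0 w] e]] m0]] := H _ 0%N; first by clear -hN; lia.
by move: m0; rewrite -e (W_r_right w).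
Qed.

Lemma W_r_finite (j m : nat) : (h + j < size c)%N -> (0 < h + j)%N ->
  g c (r_of c) j%:Z = Some m -> W_finite c (r_of c) j%:Z.
Proof.
move=> hj hj0 gm; have := g_spec hj; rewrite gm => -[_ mx].
exists [seq ([::], w) | w <- walks (nth origin c (h + j)) m] => x0 x1 w.
have x00 : x0 = [::] by apply: W_r_left w => //; clear -hj0; lia.
rewrite x00 in w *; apply/mapP; exists x1 => //; apply: mem_walks.
  have [c' _] := (W_r j [::] x1).1 w; move: c'.
  by rewrite (take_nth origin hj) cat_rcons; apply: config_path.
by apply: mx; exists x1; split=> //; exists [::].
Qed.

Lemma free_left_long : (0 < h)%N -> free_left c -> forall M, exists x0,
  [/\ (M < size x0)%N, is_config (x0 ++ behead c) &
      forall p, p \in behead c -> bc (x0 ++ behead c) p =1 bc c p].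
Proof.
move=> h0; have hN := origin_lt cc; rewrite -/h in hN.
have bE : take (h + (size c - h).-1) (behead c) = behead c.
  by rewrite take_oversize // size_behead; clear -hN; lia.
have sE : (h + (size c - h).-1).+1 = size c by clear -hN; lia.
have bc_idx x : (forall k, (0 < k < size c)%N -> bc x (nth origin c k) =1 bc c (nth origin c k)) ->
    forall p, p \in behead c -> bc x p =1 bc c p.
  move=> b p /(nthP origin)[k]; rewrite size_behead nth_behead => kc <-.
  by apply: b; have {}kc : (k < (size c).-1)%N := kc; clear -kc; lia.
case=> [|[_ fN] M]; first by rewrite r_ofE; clear -h0; lia.
have := @sup_nat_epsilon (fun n => exists x0, U c (r_of c + 1)%R (s_of c) x0 /\ size x0 = n).
rewrite -/(f _ _ _) fN => /(_ _)/(_ M)[].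
  (* The extension by [p_r] alone shows that the set of lengths is nonempty, so [f] is its true
     supremum. *)
  exists 1%N, [:: nth origin c 0]; split=> //; exists [::].
  rewrite s_ofE; apply/W_r1; rewrite bE cats0 /=.
  by case: (c) hN cc.
move=> _ [[x0 [[x1 w] <-]] Mx]; exists x0.
move: w; rewrite s_ofE => /W_r1; rewrite bE sE => -[c' b].
(* [p_s] is an end of [c], hence of the extension; as [x0] is nonempty it is the right end. *)
suff x10 : x1 = [::] by rewrite x10 !cats0 in c' b; split=> //; apply: bc_idx.
have l0 : ((size c).-1 < size c)%N by clear -hN; lia.
have sb : size (behead c) = (size c).-1 by rewrite size_behead.
have e : nth origin (x0 ++ behead c ++ x1) (size x0 + (size c).-2) = nth origin c (size c).-1.
  rewrite nth_mid ?nth_behead; last by clear -hN h0 sb; lia.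
  by congr nth; clear -hN h0; lia.
have := endpoint_transfer cc c' l0 _ _ e (b _ _); rewrite !size_cat sb => /(_ _ _ _)/orP[].
- by clear -hN h0; lia.
- by apply/orP; right; clear -hN; lia.
- by clear -hN h0; lia.
- by clear -Mx; lia.
- move=> /eqP s1; apply: size0nil.
  have {}s1 : ((size x0 + (size c).-2).+1 = size x0 + ((size c).-1 + size x1))%N := s1.
  by clear -s1 hN h0; lia.
Qed.
End translate.

(** * Upper and lower bounds for a given window *)

Section bound.
Variable c : seq pos.
Hypothesis cc : is_config c.
Let h := index origin c.

Lemma U_r1_long (j : nat) : (0 < h)%N -> free_left c -> (h + j < size c)%N ->
  forall M, exists x0, (M < size x0)%N /\ U c (r_of c + 1)%R j%:Z x0.
Proof.
move=> h0 fl hj M; have [x0 [Mx c' b]] := free_left_long cc h0 fl M.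
exists x0; split=> //; exists (drop (h + j) (behead c)); apply/W_r1.
rewrite cat_take_drop; split=> // k kn; apply: b.
have kc : (k.-1 < size (behead c))%N by rewrite size_behead; clear -kn hj; lia.
have := mem_nth origin kc; rewrite nth_behead prednK //.
by case/andP: kn.
Qed.

Lemma W_r1_infinite (j : nat) : (0 < h)%N -> free_left c -> (h + j < size c)%N ->
  ~ W_finite c (r_of c + 1)%R j%:Z.
Proof.
move=> h0 fl hj [l lP].
have [x0 [Mx [x1 w]]] := U_r1_long h0 fl hj (\max_(p <- l) size p.1)%N.
move: Mx; rewrite ltnNge => /negP[].
by apply: (@leq_bigmax_seq _ l xpredT (fun p => size p.1) _ (lP _ _ w)).
Qed.

(** Let [d] be the window followed by [x1]. By the first bound on [t], news from beyond the window
    has not come back to [p_r], so [d] would fire with [c]. By the second, news of [p_r] has not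
    reached the last node of [d]. Finiteness of [W] makes CNI applicable; the alternative bound says
    directly that the last node of [d] is asleep. *)
Lemma window_not_fires A t (j : nat) x1 : solution A -> free_left c -> CNI c ->
  (h + j < size c)%N -> W c (r_of c) j%:Z [::] x1 ->
  (t < h + 2 * j.+1)%N -> (t < 2 * h + j + size x1)%N ->
  W_finite c (r_of c) j%:Z \/ (t < j + size x1)%N -> ~ fires_at A c t.
Proof.
move=> sol fl cni hj w tj tx hfin ft.
have [c' ag] := (W_r_agrees x1 hj).1 w.
set n := (h + j).+1 in c' ag *; set d := take n c ++ x1 in c' ag.
have sy : size (take n c) = n by rewrite size_takel.
have hy : index origin (take n c) = h.
  have := cat_take_drop n c; move/(congr1 (index origin)); rewrite index_cat -/h.
  case: ifP => // _; rewrite sy => e; exfalso; clear -e; move: (index _ _) e => m; rewrite /n; lia.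
have oy : origin \in take n c by rewrite -index_mem hy sy /n; clear; lia.
have hd : index origin d = h by rewrite /d index_cat oy.
have sd : size d = (n + size x1)%N by rewrite size_cat sy.
have c1 : is_config ([::] ++ take n c ++ drop n c) by rewrite /= cat_take_drop.
have cd : is_config ([::] ++ take n c ++ x1) by [].
have y0 : nth origin (take n c) 0 = nth origin c 0 by rewrite nth_take.
have fd : fires_at A d t.
  apply: (@fires_transfer _ c _ _ (nth origin c 0)) ft => //.
  - by apply: mem_nth; apply: leq_ltn_trans hj.
  - by case: (ag 0%N).
  move=> t' tt.
  have := @light_cone A [::] (take n c) (drop n c) [::] x1 t' 0 c1 cd oy.
  rewrite /= cat_take_drop y0; apply.
  - move=> p /(nthP origin)[k]; rewrite sy => kn <- i; rewrite nth_take //.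
    by have [_ ->] := ag k kn.
  - by rewrite sy.
  - by left.
  - by right; rewrite hy sy /n; clear -tt tj; lia.
have [tl|tl] := ltnP t (j + size x1).
  have ld : ((size d).-1 < size d)%N by rewrite sd /n; clear; lia.
  by have := fires_dist c' fd ld; rewrite hd sd /n; clear -tl; lia.
have h0 : (0 < h)%N by clear -tl tx; lia.
have {hfin} fin : W_finite c (r_of c) j%:Z by case: hfin => //; rewrite ltnNge tl.
apply: (long_left_not_fires c' sol) fd; rewrite ?hd //.
  by rewrite sd /n; clear -tx; lia.
move=> M; have [x0 [Mx Ux]] := U_r1_long h0 fl hj M.
have bE : behead d = take (h + j) (behead c) ++ x1.
  by rewrite /d /n; case: (c) hj.
(* The pair [(r + 1, j)] is in [I]: [W(r,j)] is finite, while the free left hand makes [W(r + 1, j)]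
   infinite. *)
have ni : NI c (r_of c + 1)%R j%:Z.
  have rE := r_ofE c; have sE := s_ofE cc; rewrite -/h in rE sE.
  apply: cni.
  - by rewrite rE; clear -h0; lia.
  - by rewrite sE; clear -hj; lia.
  left; split; first by rewrite addrK.
  by rewrite addrK; split=> //; apply: W_r1_infinite.
have Vx : V c (r_of c + 1)%R j%:Z x1.
  exists [:: nth origin c 0]; apply/W_r1.
  have dE : [:: nth origin c 0] ++ take (h + j) (behead c) ++ x1 = d.
    by rewrite /d /n; case: (c) hj.
  rewrite dE; split=> // k kn; have kn' : (k < n)%N by case/andP: kn.
  by have [_ +] := ag k kn'.
have [c2 b2] := (W_r1 _ _ _ _).1 (ni _ _ Ux Vx).
exists x0; rewrite bE; split=> // p pd.
have sb : size (take (h + j) (behead c)) = (h + j)%N.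
  by rewrite size_takel // size_behead; clear -hj; lia.
have dE : d = [:: nth origin c 0] ++ behead d by rewrite /d /n; case: (c) hj.
have [k kb ek] := nthP origin pd; have {}kb : (k < h + j + size x1)%N by rewrite size_cat sb in kb.
(* Window nodes keep their boundary conditions by membership in [W]; nodes of [x1] do not see the
   left extension. *)
have [kn|kn] := ltnP k (h + j).
  have pE : p = nth origin c k.+1 by rewrite -ek nth_cat sb kn nth_take // nth_behead.
  move=> i; rewrite pE b2; last by clear -kn; lia.
  by have [_ ->] := ag k.+1 kn.
move=> i; rewrite dE bE -ek.
have c3 : is_config ([:: nth origin c 0] ++ take (h + j) (behead c) ++ x1) by rewrite -bE -dE.
rewrite !bc_tail // size_cat sb kb andbT; clear -kn h0; lia.
Qed.
Let s := (size c - h).-1.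

Lemma mft_upper (j m T : nat) : (j <= s)%N -> g c (r_of c) j%:Z = Some m ->
  (2 * h + j + m <= T)%N -> (2 * j + h <= T)%N ->
  exists A, solution A /\ exists t : nat, fires_at A c t /\ (T%:Z = t%:Z)%R.
Proof.
move=> js gm T1 T2; have hN := origin_lt cc; rewrite -/h in hN.
have hj : (h + j < size c)%N by move: js; rewrite /s; clear -hN; lia.
have nc : (0 < (h + j).+1 <= size c)%N by [].
have oy : origin \in take (h + j).+1 c.
  by rewrite -(nth_origin cc) -(@nth_take (h + j).+1) ?mem_nth ?size_takel // -/h; clear; lia.
have wT : (2 * (h + j).+1 <= T + (index origin c).+2)%N by rewrite -/h; clear -T2; lia.
have tot x : is_config (take (h + j).+1 c ++ x) -> agrees c (h + j).+1 (take (h + j).+1 c ++ x) ->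
   (index origin c + size (take (h + j).+1 c ++ x) <= T.+1)%N.
  move=> c' ag; have w := (W_r_agrees x hj).2 (conj c' ag).
  have := g_spec cc hj; rewrite gm => -[_ /(_ (size x))] => /(_ _) mx.
  have {}mx : (size x <= m)%N by apply: mx; exists x; split=> //; exists [::].
  by rewrite size_cat size_takel // -/h; clear -mx T1; lia.
exists (recognizer squad c (h + j).+1 T); split.
  by move=> d cd; apply: (recognizer_fires squad_solution cc nc oy wT tot).
exists T; split=> //.
have := @recognizer_agrees squad c (h + j).+1 T cc nc oy wT tot (drop (h + j).+1 c).
rewrite cat_take_drop; apply=> // k kn; split=> //.
by rewrite mem_nth // (leq_trans kn).
Qed.

Lemma mft_lower (j T : nat) : free_left c -> CNI c -> (j <= s)%N -> (T <= h + 2 * j.+1)%N ->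
  (forall m, g c (r_of c) j%:Z = Some m -> T <= 2 * h + j + m)%N ->
  forall A (t : nat), solution A -> fires_at A c t -> (T%:Z <= t%:Z)%R.
Proof.
move=> fl cni js Tj Tm A t sol ft; rewrite lez_nat leqNgt; apply/negP => tT.
have hN := origin_lt cc; rewrite -/h in hN.
have hj : (h + j < size c)%N by move: js; rewrite /s; clear -hN; lia.
have := g_spec cc hj; case gE : (g _ _ _) => [m'|].
  case=> -[x1 [[x0 w] sx]] _; have {}Tm := Tm _ gE.
  have x00 : x0 = [::].
    by apply: (W_r_left cc hj) w; rewrite sx -/h; clear -Tm tT; lia.
  rewrite x00 in w; apply: (window_not_fires sol fl cni hj w) ft.
  - by clear -tT Tj; lia.
  - by rewrite sx; clear -tT Tm; lia.
  (* If the window is the general alone, the bound on [T] reduces to [size x1], and the last node is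
     still asleep. *)
  have [hj0|hj0] := posnP (h + j); last by left; apply: W_r_finite gE.
  by right; rewrite sx; clear -Tm tT hj0; lia.
(* [g] is infinite: choose [x1] longer than [t]. *)
case/(_ t) => _ [[x1 [[x0 w] <-]] tx].
have x00 : x0 = [::].
  by apply: (W_r_left cc hj) w; clear -tx; lia.
rewrite x00 in w; apply: (window_not_fires sol fl cni hj w) ft.
- by clear -tT Tj; lia.
- by clear -tx; lia.
- by right; clear -tx; lia.
Qed.
End bound.

(** * The three cases of the formula *)

Local Open Scope ring_scope.

Theorem theorem13 (c : seq pos) :
  is_config c -> free_left c -> CNI c ->
  (s_of c < - r_of c -> mft_is c (- 2 * r_of c + s_of c)) /\
  (- r_of c <= s_of c ->
   exists j0 : int,
     [/\ 0 <= j0 <= s_of c, cond_j c j0,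
         (forall j : int, 0 <= j < j0 -> ~ cond_j c j) &
         (forall n : nat, g c (r_of c) j0 = Some n ->
            (- r_of c + n%:Z = j0 + 1 -> mft_is c (- r_of c + 2 * j0 + 1)) /\
            (- r_of c + n%:Z < j0 + 1 -> mft_is c (- r_of c + 2 * j0)))]).
Proof.
move=> cc fl cni.
have hN := origin_lt cc.
have rE := r_ofE c; have sE := s_ofE cc.
set h := index origin c in hN rE sE.
set s := (size c - h).-1 in sE.
have hs : (h + s).+1 = size c by rewrite /s; clear -hN; lia.
have gs : g c (r_of c) s%:Z = Some 0%N by rewrite -sE g_end.
split.
  rewrite sE rE => sh; have {}sh : (s < h)%N by clear -sh; lia.
  have -> : - 2 * - h%:Z + s%:Z = (2 * h + s)%N%:Z by clear; lia.
  split.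
    (* The window is all of [c], with [g(r,s) = 0]; since [s < h], the time [2h + s] exceeds
       [h + 2s]. *)
    by apply: (mft_upper cc _ gs) => //; clear -sh; lia.
  move=> A t sol ft; rewrite lez_nat leqNgt; apply/negP => tT.
  have h0 : (0 < h)%N by clear -sh; lia.
  apply: (long_left_not_fires cc sol h0) ft; last exact: free_left_long.
  by rewrite -/h -hs; clear -tT; lia.
pose P (j : nat) := if g c (r_of c) j%:Z is Some m then (h + m <= j.+1)%N else false.
have PE (j : nat) : cond_j c j%:Z <-> P j.
  rewrite /cond_j /P rE; case: (g _ _ _) => [m|] //.
  by split=> H; clear -H; lia.
rewrite sE {1}rE => hs'; have {}hs' : (h <= s)%N by clear -hs'; lia.
have Ps : P s by rewrite /P gs; clear -hs'; lia.
have exP : exists j, P j by exists s.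
case: (ex_minnP exP) => j0 Pj0 minj0.
have j0s := minj0 s Ps.
exists j0%:Z; split.
- by clear -j0s; lia.
- exact/PE.
- move=> [j|j] jj0; last by exfalso; clear -jj0; lia.
  by move/PE/minj0; clear -jj0; lia.
move=> m gm; split; rewrite rE => hm.
- have {}hm : (h + m = j0.+1)%N by clear -hm; lia.
  have -> : - - h%:Z + 2 * j0%:Z + 1 = (h + 2 * j0)%N.+1%:Z by clear; lia.
  split; first by apply: (mft_upper cc _ gm) => //; clear -hm; lia.
  (* Here [2h + j0 + m = h + 2 j0 + 1], so the window of [j0] gives both bounds. *)
  apply: (mft_lower cc fl cni j0s); first by clear; lia.
  by move=> m'; rewrite gm => -[<-]; clear -hm; lia.
- have {}hm : (h + m <= j0)%N by clear -hm; lia.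
  have -> : - - h%:Z + 2 * j0%:Z = (h + 2 * j0)%N%:Z by clear; lia.
  split; first by apply: (mft_upper cc _ gm) => //; clear -hm; lia.
  (* The lower bound comes from the window of [j0 - 1]: by minimality, [g] there is infinite or some
     [m'] with [h + m' > j0], so that [2h + (j0 - 1) + m' >= h + 2 j0]. For [j0 = 0] also [h = 0]
     and the claimed time is 0. *)
  case: j0 minj0 hm {Pj0 gm} j0s => [|j] minj hm j0s.
    by move=> A t _ _; clear -hm; lia.
  apply: (mft_lower (j := j) cc fl cni) => //; first exact: ltnW.
  move=> m' gm'; have nP : ~~ P j by apply/negP => /minj; rewrite ltnn.
  by move: nP; rewrite /P gm'; clear; lia.
Qed.
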